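(* Consider the stochastic regression model $y_{k+1}=\varphi_k^T\theta+w_{k+1}$, $k\ge0$, with unknown parameter $\theta\in\mathbb{R}^r$, and assume: (i) the noise $\{w_k,\mathcal{F}_k\}_{k\ge1}$ is a martingale difference sequence, i.e. $\mathbb{E}[w_{k+1}\mid\mathcal{F}_k]=0$, $k\ge1$, and there exists some $\gamma>2$ such that $\sup_k\mathbb{E}[|w_{k+1}|^\gamma\mid\mathcal{F}_k]<\infty$ a.s.; (ii) $\lim_{n\to\infty}\dfrac{\log R_n}{\lambda_{\min}^n}=0$ a.s. Then the sparse estimates $\beta_{N+1}$ generated by the thresholded recursive least squares algorithm described in the context have the following convergence rate as $N\to\infty$: $$\|\beta_{N+1}-\theta\|=O\left(\sqrt{\frac{\log R_N}{\lambda_{\min}^N}}\right)\quad\text{a.s.}$$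
   Context: The probability space is $(\Omega,\mathcal{F},\mathcal{P})$. Here $y_{k+1}$ is the scalar observation, $\varphi_k\in\mathbb{R}^r$ is a stochastic regression vector (which may be a function of current and past inputs and outputs), and $w_{k+1}$ is the scalar noise. $v(l)$ denotes the $l$-th coordinate of a vector $v$, and $\|\cdot\|$ is the 2-norm. Given an initial vector $\theta_0\in\mathbb{R}^r$ and an initial matrix $P_0>0$ (positive definite), set $R_n=1+\sum_{k=0}^n\|\varphi_k\|^2$ and $\lambda_{\min}^n=\lambda_{\min}\{P_0^{-1}+\sum_{k=0}^n\varphi_k\varphi_k^T\}$ (smallest eigenvalue). Thresholds: $\{\alpha_n\}$ is a chosen positive sequence satisfying $\alpha_n\to0$ as $n\to\infty$ and $\sqrt{\log R_n/\lambda_{\min}^n}=o(\alpha_n)$. Algorithm (recursive least squares followed by thresholding): for $k\ge0$, $a_k=\dfrac{1}{1+\varphi_k^TP_k\varphi_k}$, $\;P_{k+1}=P_k-a_kP_k\varphi_k\varphi_k^TP_k$, $\;\theta_{k+1}=\theta_k+a_kP_k\varphi_k\{y_{k+1}-\varphi_k^T\theta_k\}$. The sparse estimate $\beta_{n+1}=(\beta_{n+1}(1),\dots,\beta_{n+1}(r))^T$ is given by $\beta_{n+1}(l)=0$ if $|\theta_{n+1}(l)|<\alpha_{n+1}$, and $\beta_{n+1}(l)=\theta_{n+1}(l)$ otherwise.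
   Formalization: Adds that almost surely some φ_k is nonzero (if all φ_k = 0 then log R_N = 0 and the claimed rate O(0) fails when θ_0 ≠ θ), and makes explicit that φ_k is F_k-measurable, without which the claim also fails (e.g. φ_k = sign w_{k+1}). *)

(* Defs.v *)
From HB Require Import structures.
From mathcomp Require Import all_boot all_order all_algebra.
From mathcomp Require Import all_classical all_reals all_analysis.
From mathcomp Require Import measurable_realfun.

Set Implicit Arguments.
Unset Strict Implicit.
Unset Printing Implicit Defensive.

Import Order.TTheory GRing.Theory Num.Theory.
Import numFieldNormedType.Exports.

Local Open Scope classical_set_scope.
Local Open Scope ring_scope.

Section LinearAlgebra.
Variables (R : realType) (r : nat).

(* The canonical norm [`|v|] on matrices is the max norm, hence this one. *)
Definition norm2 (v : 'cV[R]_r) : R := Num.sqrt (\sum_i (v i 0) ^+ 2).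

Definition posdefmx (A : 'M[R]_r) : Prop :=
  A^T = A /\ forall x : 'cV[R]_r, x != 0 -> 0 < (x^T *m A *m x) 0 0.

(* The infimum is a minimum when A has a real eigenvalue, as every symmetric
   A with r > 0 does. *)
Definition lambda_min (A : 'M[R]_r) : R := inf [set a | eigenvalue A a].

End LinearAlgebra.

(* Deterministic, along one trajectory of the
   regressors phi and the observations y. *)
Section RLS.
Variables (R : realType) (r : nat).
Variables (theta0 : 'cV[R]_r) (P0 : 'M[R]_r).
Variables (phi : nat -> 'cV[R]_r) (y : nat -> R).

Definition rls_gain (P : 'M[R]_r) (k : nat) : R :=
  (1 + ((phi k)^T *m P *m phi k) 0 0)^-1.

Fixpoint rls_P (k : nat) : 'M[R]_r :=
  if k is j.+1 then
    rls_P j - rls_gain (rls_P j) j *: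
      (rls_P j *m phi j *m (phi j)^T *m rls_P j)
  else P0.

Fixpoint rls_theta (k : nat) : 'cV[R]_r :=
  if k is j.+1 then
    rls_theta j +
      (rls_gain (rls_P j) j * (y j.+1 - ((phi j)^T *m rls_theta j) 0 0)) *:
        (rls_P j *m phi j)
  else theta0.

Definition sparse_estimate (alpha : nat -> R) (k : nat) : 'cV[R]_r :=
  \col_l (if `|rls_theta k l 0| < alpha k then 0 else rls_theta k l 0).

Definition Rsum (n : nat) : R := 1 + \sum_(0 <= k < n.+1) norm2 (phi k) ^+ 2.

Definition lambda_min_seq (n : nat) : R :=
  lambda_min (invmx P0 + \sum_(0 <= k < n.+1) phi k *m (phi k)^T).

End RLS.

Section Probability.
Context {d : measure_display} {Omega : measurableType d} {R : realType}.
Variable P : probability Omega R.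

(* f is measurable from (Omega, G) to T', for a sub-sigma-algebra G. *)
Definition measurable_wrt {d'} {T' : measurableType d'}
    (G : set (set Omega)) (f : Omega -> T') : Prop :=
  measurable_fun [set: g_sigma_algebraType G]
    (f : g_sigma_algebraType G -> T').

Definition filtration (F : nat -> set (set Omega)) : Prop :=
  [/\ forall k, sigma_algebra [set: Omega] (F k),
      forall k, F k `<=` measurable &
      forall m n, (m <= n)%N -> F m `<=` F n].

(* Z is a version of E[X | G]; meant for X integrable, or X nonnegative and
   possibly not integrable, in which case Z may take the value +oo. *)
Definition is_cond_expectation (G : set (set Omega)) (X Z : Omega -> \bar R) :
    Prop :=
  measurable_wrt G Z /\
  forall A, G A -> (\int[P]_(x in A) Z x = \int[P]_(x in A) X x)%E.

(* The sequence starts at index 1: w_1 is adapted and integrable but not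
   required to be centred. *)
Definition martingale_difference (F : nat -> set (set Omega))
    (w : nat -> Omega -> R) : Prop :=
  [/\ forall k, (1 <= k)%N -> measurable_wrt (F k) (w k),
      forall k, (1 <= k)%N -> P.-integrable setT (EFin \o w k) &
      forall k, (1 <= k)%N ->
        is_cond_expectation (F k) (EFin \o w k.+1) (cst 0%E)].

(* sup_k E[ |w_{k+1}|^gamma | F_k ] < oo a.s.; the conditional expectations
   are determined up to null sets, so the choice of versions Z is
   irrelevant. *)
Definition bounded_cond_moment (F : nat -> set (set Omega))
    (w : nat -> Omega -> R) (gamma : R) : Prop :=
  exists Z : nat -> Omega -> \bar R,
    (forall k, (1 <= k)%N ->
       is_cond_expectation (F k)
         (fun x => (`|w k.+1 x| `^ gamma)%:E) (Z k)) /\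
    {ae P, forall x, (ereal_sup [set Z k x | k in [set k | (1 <= k)%N]] < +oo)%E}.

End Probability.

(* Main.v *)
Require Import Defs.
From HB Require Import structures.
From mathcomp Require Import all_boot all_order all_algebra.
From mathcomp Require Import all_classical all_reals all_analysis.
From mathcomp Require Import measurable_realfun perm ring lra.
Import Order.TTheory GRing.Theory Num.Theory.
Import numFieldNormedType.Exports.
Local Open Scope classical_set_scope.
Local Open Scope ring_scope.

Set Implicit Arguments.
Unset Strict Implicit.
Unset Printing Implicit Defensive.

(** Write [t_k = theta_k - theta], [Q_k = P_k^-1], [V_k = t_k^T Q_k t_k],
    [u_k = phi_k^T t_k] and [delta_k = 1 - a_k]. Then
      [V_(k+1) + a_k u_k^2 = V_k + 2 a_k u_k w_(k+1) + delta_k w_(k+1)^2],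
    and [lambda_min(Q_k) |t_k|^2 <= V_k], so it suffices that [V_(n+1) = O(log R_n)].
    The martingale [sum a_k u_k w_(k+1)] is [O((1 + sum a_k u_k^2)^(3/4))] almost
    surely, which the left-hand side absorbs; the sum of [delta_k w_(k+1)^2] is
    [O(1 + sum delta_k)] by the conditional moment of order [gamma > 2]; and
    [delta_k <= log det Q_(k+1) - log det Q_k] telescopes to [O(log R_n)].
    Both almost sure bounds come from Ville's maximal inequality for a nonnegative
    supermartingale, restricted to the events where the conditional moments stay
    below a constant. Thresholding sets to [0] only coordinates with
    [theta(l) = 0], once [alpha_n] is small, and so never increases the error:
    the rate of [theta_n] passes to [beta_n]. *)

(** * Domination in conditional expectation and a maximal inequality *)

Section ConditionalDomination.
Import HBNNSimple.
Context {d : measure_display} {Omega : measurableType d} {R : realType}.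
Variable P : probability Omega R.
Implicit Types (F : set (set Omega)) (A G : set Omega) (f g h k U V W X Y : Omega -> R).

(** For [G] in [F] and nonnegative functions this is E[U | F] <= E[V | F] almost surely on [G].
    Testing on events of [F] avoids constructing conditional expectations and allows infinite
    integrals. *)
Definition cond_le F G U V : Prop := forall A, F A -> A `<=` G ->
  (\int[P]_(x in A) (U x)%:E <= \int[P]_(x in A) (V x)%:E)%E.

Lemma measurable_wrt_sub F {d'} {T' : measurableType d'} (f : Omega -> T') :
  sigma_algebra setT F -> F `<=` measurable ->
  measurable_wrt F f -> measurable_fun setT f.
Proof.
move=> FS FD mf _ B mB; apply: FD.
have := mf measurableT B mB.
by rewrite measurable_g_measurableTypeE.
Qed.

Lemma measurable_wrt_preimage F {d'} {T' : measurableType d'}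
    (f : Omega -> T') B :
  sigma_algebra setT F -> measurable_wrt F f -> measurable B -> F (f @^-1` B).
Proof.
move=> FS mf mB; have := mf measurableT B mB.
by rewrite measurable_g_measurableTypeE// setTI.
Qed.

Lemma sigma_algebra_setI F A B : sigma_algebra setT F -> F A -> F B -> F (A `&` B).
Proof.
move=> FS FA FB.
have : measurable ((A : set (g_sigma_algebraType F)) `&` B).
  by apply: measurableI; rewrite measurable_g_measurableTypeE.
by rewrite measurable_g_measurableTypeE.
Qed.

(** An [F]-measurable factor comes out of the conditional expectation: for simple [h] the claim
    splits over the level sets, and monotone convergence gives the general case. *)
Lemma cond_leM F G U V h :
  sigma_algebra setT F -> F `<=` measurable ->
  measurable_fun setT U -> (forall x, 0 <= U x) ->
  measurable_fun setT V -> (forall x, 0 <= V x) ->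
  measurable_wrt F h -> (forall x, 0 <= h x) ->
  cond_le F G U V -> cond_le F G (h \* U) (h \* V).
Proof.
move=> FS FD mU U0 mV V0 mh h0 UV A FA AG.
have mh' : measurable_fun [set: g_sigma_algebraType F] (EFin \o h).
  exact/measurable_EFinP.
(* The approximation is taken in the sigma-algebra generated by [F], so the level sets of each [a n]
   belong to [F] and [UV] applies on their intersections with [A]. *)
pose a := nnsfun_approx measurableT mh'.
have mA := FD _ FA.
have Fa n y : F (a n @^-1` [set y]).
  have := @measurable_sfunP _ _ _ _ (a n) [set y] (measurable_set1 y).
  by rewrite measurable_g_measurableTypeE.
have mainE (W : Omega -> R) : measurable_fun setT W -> (forall x, 0 <= W x) ->
    (\int[P]_(x in A) ((a n x * W x)%:E))%E @[n --> \oo] --> (\int[P]_(x in A) (h x * W x)%:E)%E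
    /\ forall n, (\int[P]_(x in A) ((a n x * W x)%:E) =
      \sum_(y \in range (a n)) (y%:E * \int[P]_(x in A `&` a n @^-1` [set y]) (W x)%:E))%E.
  move=> mW W0; split.
    rewrite (_ : (\int[P]_(x in A) (h x * W x)%:E)%E =
      (\int[P]_(x in A) limn (fun n => (a n x * W x)%:E))%E); last first.
      apply: eq_integral => x _; apply/esym/cvg_lim => //.
      under eq_fun do rewrite EFinM.
      rewrite EFinM; apply: cvgeZr => //.
      apply: (@cvg_nnsfun_approx _ (g_sigma_algebraType F) R setT
        measurableT (EFin \o h) mh' _ x Logic.I).
      by move=> z _; rewrite lee_fin.
    apply: cvg_monotone_convergence => //.
    - move=> n; apply/measurable_EFinP; apply: measurable_funTS.
      apply: measurable_funM => //.
      have : measurable_wrt F (a n : Omega -> R) by exact: measurable_funP.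
      exact: measurable_wrt_sub.
    - by move=> n x _; rewrite lee_fin mulr_ge0.
    - move=> x _ n m nm; rewrite lee_fin ler_wpM2r//.
      by have /lefP := nd_nnsfun_approx measurableT mh' nm; exact.
  move=> n.
  transitivity (\int[P]_(x in A)
      (\sum_(y \in range (a n)) (y * (\1_(a n @^-1` [set y]) x * W x))%:E))%E.
    apply: eq_integral => x _; rewrite {1}fimfunE.
    rewrite fsumEFin//; congr EFin.
    rewrite !fsbig_finite//= big_distrl/=.
    by apply: eq_bigr => y _; rewrite mulrA.
  have ind y : measurable_fun A (fun x => \1_(a n @^-1` [set y]) x * W x).
    apply: measurable_funTS; apply: measurable_funM => //.
    by apply: measurable_indic; exact: FD.
  rewrite ge0_integral_fsum//; last 2 first.
  - move=> y; apply/measurable_EFinP; apply: measurable_funM => //.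
  - move=> y x _; rewrite lee_fin mulrA mulr_ge0//.
    have := @nnfun_muleindic_ge0 _ _ R (a n) y x.
    by rewrite -EFinM lee_fin.
  apply: eq_fsbigr => y /[!inE] -[x _ <-].
  have y0 : 0 <= a n x by [].
  move: (a n x) y0 => v v0.
  rewrite -ge0_integralZl//; last 3 first.
  - exact: measurableI (FD _ (Fa n v)).
  - by apply/measurable_EFinP; apply: measurable_funTS.
  - by move=> z _; rewrite lee_fin.
  rewrite integral_mkcondr; apply: eq_integral => z _.
  rewrite /patch indicE; case: ifPn => _; rewrite ?(mul1r, mul0r, mulr0)//.
have [cU eU] := mainE U mU U0; have [cV eV] := mainE V mV V0.
apply: (lee_cvg_to cU cV); apply: nearW => n; rewrite eU eV.
apply: lee_fsum => // y [x _ <-].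
apply: lee_wpmul2l; first by rewrite lee_fin.
apply: UV; last by move=> z [] /AG.
exact: sigma_algebra_setI.
Qed.


Lemma le_cond_le F G U V : F `<=` measurable ->
  measurable_fun setT U -> (forall x, 0 <= U x) -> measurable_fun setT V ->
  (forall x, U x <= V x) -> cond_le F G U V.
Proof.
move=> FD mU U0 mV UV A FA AG; apply: ge0_le_integral.
- exact: FD.
- by move=> x _; rewrite lee_fin.
- by apply/measurable_EFinP; apply: measurable_funTS.
- by apply/measurable_EFinP; apply: measurable_funTS.
- by move=> x _; rewrite lee_fin.
Qed.

Lemma cond_le_trans F G U V W :
  cond_le F G U V -> cond_le F G V W -> cond_le F G U W.
Proof. by move=> UV VW A FA AG; exact: le_trans (UV A FA AG) (VW A FA AG). Qed.

Lemma ge0_integral_EFinD A f g : measurable A ->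
  measurable_fun setT f -> (forall x, 0 <= f x) ->
  measurable_fun setT g -> (forall x, 0 <= g x) ->
  (\int[P]_(x in A) ((f \+ g) x)%:E =
   \int[P]_(x in A) (f x)%:E + \int[P]_(x in A) (g x)%:E)%E.
Proof.
move=> mA mf f0 mg g0; under eq_integral do rewrite /= EFinD.
rewrite ge0_integralD//.
- by move=> x _; rewrite lee_fin.
- by apply/measurable_EFinP; apply: measurable_funTS.
- by move=> x _; rewrite lee_fin.
- by apply/measurable_EFinP; apply: measurable_funTS.
Qed.

Lemma cond_leD F G U V U' V' : F `<=` measurable ->
  measurable_fun setT U -> (forall x, 0 <= U x) ->
  measurable_fun setT V -> (forall x, 0 <= V x) ->
  measurable_fun setT U' -> (forall x, 0 <= U' x) ->
  measurable_fun setT V' -> (forall x, 0 <= V' x) ->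
  cond_le F G U V -> cond_le F G U' V' -> cond_le F G (U \+ U') (V \+ V').
Proof.
move=> FD mU U0 mV V0 mU' U0' mV' V0' UV UV' A FA AG.
rewrite !ge0_integral_EFinD//; try exact: FD.
by apply: leeD; [exact: UV|exact: UV'].
Qed.

(* Dividing by [1 + k] makes the terms to be cancelled integrable. *)
Lemma cond_le_cancel F G U V X Y k : sigma_algebra setT F -> F `<=` measurable ->
  measurable_fun setT U -> (forall x, 0 <= U x) ->
  measurable_fun setT V -> (forall x, 0 <= V x) ->
  measurable_fun setT X -> (forall x, 0 <= X x) ->
  measurable_fun setT Y -> (forall x, 0 <= Y x) ->
  measurable_wrt F k -> (forall x, 0 <= k x) ->
  (\int[P]_x ((1 + k x)^-1 * V x)%:E < +oo)%E ->
  (forall x, X x + V x <= Y x + U x) ->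
  cond_le F G U V -> cond_le F G X Y.
Proof.
move=> FS FD mU U0 mV V0 mX X0 mY Y0 mk k0 Vfin XVYU UV.
have k1_gt0 x : 0 < 1 + k x by rewrite ltr_pwDl.
pose e x := (1 + k x)^-1.
have e0 x : 0 <= e x by rewrite invr_ge0 ltW.
have me : measurable_wrt F e.
  (* Writing the inverse of a positive quantity as the power -1 gives access to the measurability of
     real powers. *)
  have -> : e = fun x => (1 + k x) `^ (-1).
    by apply/funext => x; rewrite /e powR_inv1// ltW.
  rewrite /measurable_wrt; apply: (measurableT_comp (measurable_powR (-1))).
  by apply: measurable_funD => //; exact: mk.
have me' := measurable_wrt_sub FS FD me.
have mM W : measurable_fun setT W -> measurable_fun setT (e \* W).
  by move=> mW; exact: measurable_funM.
have M0 W : (forall x, 0 <= W x) -> forall x, 0 <= (e \* W) x.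
  by move=> W0 x; rewrite mulr_ge0.
have eXY : cond_le F G (e \* X) (e \* Y).
  move=> A FA AG; have mA := FD _ FA.
  have finV : (\int[P]_(x in A) ((e \* V) x)%:E)%E \is a fin_num.
    rewrite ge0_fin_numE; last by apply: integral_ge0 => x _; rewrite lee_fin M0.
    apply: le_lt_trans Vfin; apply: ge0_subset_integral => //.
      by apply/measurable_EFinP; exact: mM.
    by move=> x _; rewrite lee_fin M0.
  rewrite -(leeD2rE _ _ finV).
  rewrite -ge0_integral_EFinD//; try solve [exact: mM|exact: M0].
  apply: (@le_trans _ _ (\int[P]_(x in A) (((e \* Y) \+ (e \* U)) x)%:E)%E).
    apply: ge0_le_integral => //.
    - by move=> x _; rewrite lee_fin addr_ge0// M0.
    - by apply/measurable_EFinP; apply: measurable_funTS; apply: measurable_funD; exact: mM.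
    - by apply/measurable_EFinP; apply: measurable_funTS; apply: measurable_funD; exact: mM.
    - by move=> x _; rewrite lee_fin/= -!mulrDr ler_wpM2l.
  rewrite ge0_integral_EFinD//; try solve [exact: mM|exact: M0].
  by apply: leeD2l; exact: (cond_leM FS FD mU U0 mV V0 me e0 UV).
(* Multiplying back by the [F]-measurable function [1 + k] undoes the normalization. *)
have mk1 : measurable_wrt F (fun x => 1 + k x).
  by apply: measurable_funD => //; exact: mk.
have := cond_leM FS FD (mM _ mX) (M0 _ X0) (mM _ mY) (M0 _ Y0) mk1
  (fun x => ltW (k1_gt0 x)) eXY.
have E W : (fun x => 1 + k x) \* (e \* W) = W.
  by apply/funext => x /=; rewrite mulrA mulfV ?mul1r// gt_eqF.
by rewrite !E.
Qed.

(** Ville's inequality by stopping at the first passage above a level [l]: the stopped mean never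
    exceeds the integral at time 0, so the probability of ever passing [l] while all [G n] hold is
    at most that integral divided by [l]. The events [G n] localize: the supermartingale inequality
    is required only on them. *)
Lemma nonneg_supermartingale_bounded (F : nat -> set (set Omega))
    (G : nat -> set Omega) (X : nat -> Omega -> R) :
  filtration F -> (forall n, F n (G n)) -> (forall n, G n.+1 `<=` G n) ->
  (forall n, measurable_wrt (F n) (X n)) -> (forall n x, 0 <= X n x) ->
  (forall n, cond_le (F n) (G n) (X n.+1) (X n)) ->
  (\int[P]_(x in G 0%N) (X 0%N x)%:E < +oo)%E ->
  {ae P, forall x, (forall n, G n x) -> exists B, forall n, X n x <= B}.
Proof.
move=> [FS FD FI] FG Gdec mX X0 XX Xfin.
pose Ginf := \bigcap_n G n.
have mGinf : measurable Ginf by apply: bigcapT_measurable => n; exact: FD (FG n).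
pose c := (\int[P]_(x in G 0%N) (X 0%N x)%:E)%E.
have c_fin : c \is a fin_num.
  by rewrite ge0_fin_numE//; apply: integral_ge0 => x _; rewrite lee_fin.
have mX' n := measurable_wrt_sub (FS n) (FD n) (mX n).
pose E l := Ginf `&` \bigcup_n [set x | l < X n x].
have mE l : measurable (E l).
  apply: measurableI => //; apply: bigcupT_measurable => n.
  rewrite -[X in measurable X]setTI.
  by apply: measurable_fun_ltr => //.
have PE l : 0 < l -> (l%:E * P (E l) <= c)%E.
  move=> l0.
  (* [H n] is the event that the [G m] hold and [X m] stays at most [l] for all m <= n. Below, [C n]
     is the part of [Ginf] where the first passage above [l] happens at time [n.+1]. *)
  pose H := fix H n := if n is m.+1 then H m `&` (G n `&` [set x | X n x <= l])
    else G n `&` [set x | X n x <= l].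
  have FGX n : F n (G n `&` [set x | X n x <= l]).
    apply: sigma_algebra_setI => //.
    have := measurable_wrt_preimage (FS n) (mX n) (measurable_itv `]-oo, l]%R).
    by congr (F n _); apply/seteqP; split => x /=; rewrite in_itv.
  have FH n : F n (H n).
    elim: n => [|n IH] //=.
    by apply: sigma_algebra_setI => //; exact: FI IH.
  have HG n : H n `<=` G n by case: n => [|n] x /= []// _ [].
  have mH n : measurable (H n) by exact: FD (FH n).
  pose C n := (H n `&` Ginf) `\` H n.+1.
  have mC n : measurable (C n) by apply: measurableD => //; exact: measurableI.
  have intXge A n : measurable A -> A `<=` [set x | l < X n x] ->
      (l%:E * P A <= \int[P]_(x in A) (X n x)%:E)%E.
    move=> mA Al; rewrite -integral_cst//; apply: ge0_le_integral => //.
    - by move=> x _; rewrite lee_fin ltW.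
    - by apply/measurable_EFinP; apply: measurable_funTS.
    - by move=> x /Al /=; rewrite lee_fin => /ltW.
  (* The invariant splits the mean of the stopped process: [X n] on the paths not yet stopped, and
     at least [l] on the paths of [Ginf] already stopped. *)
  have key n : (\int[P]_(x in H n) (X n x)%:E + l%:E * P (Ginf `\` H n) <= c)%E.
    elim: n => [|n IH].
      have mD : measurable (Ginf `\` H 0%N) by exact: measurableD.
      apply: (@le_trans _ _ (\int[P]_(x in H 0%N `|` Ginf `\` H 0%N) (X 0%N x)%:E)%E).
        rewrite ge0_integral_setU//.
        - apply: leeD2l; apply: intXge => // x [/(_ 0%N Logic.I) G0x].
          by move=> /not_andP[//|/negP]; rewrite -ltNge.
        - by apply/measurable_EFinP; apply: measurable_funTS.
        - by move=> x _; rewrite lee_fin.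
        - by apply/disj_setPS => x [? []].
      apply: ge0_subset_integral => //.
      - exact: measurableU.
      - by apply: FD (FG _).
      - by apply/measurable_EFinP; apply: measurable_funTS.
      - by move=> x _; rewrite lee_fin.
      - by move=> x [/HG//|[/(_ 0%N Logic.I)]].
    apply: le_trans IH.
    (* The supermartingale inequality is used on [H n], which contains the disjoint sets [H n.+1]
       and [C n]; on the second one [X n.+1] exceeds [l]. *)
    have step : (\int[P]_(x in H n.+1) (X n.+1 x)%:E + l%:E * P (C n) <=
        \int[P]_(x in H n) (X n x)%:E)%E.
      apply: le_trans (XX n _ (FH n) (HG n)).
      apply: (@le_trans _ _ (\int[P]_(x in H n.+1 `|` C n) (X n.+1 x)%:E)%E).
        rewrite ge0_integral_setU//.
        - apply: leeD2l; apply: intXge => // x [[Hx] /(_ n.+1 Logic.I) Gx].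
          by move=> /not_andP[//|/not_andP[//|/negP]]; rewrite -ltNge.
        - by apply/measurable_EFinP; apply: measurable_funTS.
        - by move=> x _; rewrite lee_fin.
        - by apply/disj_setPS => x [? []].
      apply: ge0_subset_integral => //.
      - exact: measurableU.
      - by apply/measurable_EFinP; apply: measurable_funTS.
      - by move=> x _; rewrite lee_fin.
      - by move=> x [[]//|[[]]].
    have PD : (P (Ginf `\` H n.+1) <= P (C n) + P (Ginf `\` H n))%E.
      apply: le_trans (measureU2 _ _ _) => //; last exact: measurableD.
      apply: le_measure; rewrite ?inE//; first exact: measurableD.
        by apply: measurableU => //; exact: measurableD.
      move=> x [Gx Hx]; have [Hnx|Hnx] := pselect (H n x); first by left.
      by right.
    apply: (@le_trans _ _ (\int[P]_(x in H n.+1) (X n.+1 x)%:E +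
        (l%:E * P (C n) + l%:E * P (Ginf `\` H n)))%E).
      apply: leeD2l; rewrite -ge0_muleDr//.
      by apply: lee_wpmul2l => //; rewrite lee_fin ltW.
    by rewrite addeA; apply: leeD2r.
  have cvgE : P (Ginf `\` H n) @[n --> \oo] --> P (E l).
    have -> : E l = \bigcup_n (Ginf `\` H n).
      apply/seteqP; split => [x [Gx [n _ lX]]|x [n _ [Gx nHx]]].
        exists n => //; split => //; case: n lX => [|n] /= lX.
          by move=> [_]; rewrite leNgt lX.
        by move=> [_ [_]]; rewrite leNgt lX.
      split => //.
      elim: n nHx => [/= /not_andP[|/negP]|n IH /= /not_andP[//|/not_andP[|/negP]]].
      - by move/(_ (Gx 0%N Logic.I)).
      - by rewrite -ltNge => lX; exists 0%N.
      - by move/(_ (Gx n.+1 Logic.I)).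
      - by rewrite -ltNge => lX; exists n.+1.
    apply: nondecreasing_cvg_mu.
    - by move=> n; exact: measurableD.
    - by apply: bigcupT_measurable => n; exact: measurableD.
    - apply/nondecreasing_seqP => n; rewrite subsetEset => x [Gx nHx].
      by split => // -[].
  have cvglE : (l%:E * P (Ginf `\` H n))%E @[n --> \oo] --> (l%:E * P (E l))%E.
    exact: cvgeZl.
  rewrite -(cvg_lim _ cvglE)//; apply: lime_le; first by apply/cvg_ex; eexists; exact: cvglE.
  apply: nearW => n; apply: le_trans (key n); rewrite leeDr//.
  by apply: integral_ge0 => x _; rewrite lee_fin.
(* An unbounded path passes every integer level, and level [N.+1] is passed with probability at most
   [c / N.+1], which is below [e] once [N.+1] is at least [c / e]. *)
exists (\bigcap_n E n.+1%:R); split.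
- exact: bigcapT_measurable.
- apply/eqP; rewrite eq_le measure_ge0 andbT.
  apply/lee_addgt0Pr => e e0; rewrite add0e.
  have [N Nc] : exists N : nat, fine c / e <= N.+1%:R.
    exists (Num.Def.truncn (fine c / e)); apply: ltW; exact: truncnS_gt.
  apply: (@le_trans _ _ (P (E N.+1%:R))).
    by apply: le_measure; rewrite ?inE//; [exact: bigcapT_measurable|exact: bigcap_inf].
  have := PE N.+1%:R (ltr0Sn _ _).
  rewrite -lee_pdivlMl// => /le_trans; apply.
  rewrite -(fineK c_fin) -EFinM lee_fin mulrC ler_pdivrMr//.
  by rewrite mulrC -ler_pdivrMr.
- move=> x /= /not_implyP[Gx nB] n _; split => //.
  apply: contrapT => nX; apply: nB; exists n.+1%:R => m.
  by rewrite leNgt; apply/negP => lX; apply: nX; exists m.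
Qed.
End ConditionalDomination.

(** * Inequalities for real powers *)

Section RealPowers.
Context {R : realType}.
Implicit Types (a b c p s t x y z : R).

(** Convexity: the tangent of the power -s at t + c, evaluated at t, lies below the graph. With r =
    t / (t + c) it becomes 1 + s (1 - r) <= exp (- s ln r), which follows from exp x >= 1 + x used
    twice. *)
Lemma powRN_tangent t c s : 0 < t -> 0 <= c -> 0 < s ->
  (t + c) `^ (- s) + s * (c * (t + c) `^ (- s - 1)) <= t `^ (- s).
Proof.
move=> t0 c0 s0.
have tc0 : 0 < t + c by rewrite ltr_pwDl.
pose r := t / (t + c).
have r0 : 0 < r by rewrite divr_gt0.
have -> : t `^ (- s) = (t + c) `^ (- s) * r `^ (- s).
  by rewrite -powRM ?ltW// /r mulrC divfK// gt_eqF.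
have -> : (t + c) `^ (- s - 1) = (t + c) `^ (- s) * (t + c)^-1.
  by rewrite powRB ?powRr1 ?ltW// (gt_eqF tc0) implybT.
suff : 1 + s * (1 - r) <= r `^ (- s).
  move=> h; have := ler_wpM2l (powR_ge0 (t + c) (- s)) h.
  have -> : 1 - r = c * (t + c)^-1 by rewrite /r; field; rewrite gt_eqF.
  by move=> h1; apply: le_trans h1; rewrite le_eqVlt; apply/orP; left; apply/eqP; ring.
rewrite /powR gt_eqF//; apply: le_trans (expR_ge1Dx _).
have := expR_ge1Dx (ln r); rewrite lnK ?posrE// => h.
by rewrite lerD2l mulNr -mulrN; apply: ler_wpM2l; [exact: ltW|lra].
Qed.

(** For z = a or b the ratio z / (a + b) lies in [0, 1], so raising it to the power s <= 1 does not
    decrease it; the two ratios add up to 1. *)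
Lemma powRD_subadd a b s : 0 <= a -> 0 <= b -> 0 < s -> s <= 1 ->
  (a + b) `^ s <= a `^ s + b `^ s.
Proof.
move=> a0 b0 s0 s1.
have [|ab0] := leP (a + b) 0.
  move=> ab0; have -> : a + b = 0 by apply/eqP; rewrite eq_le ab0 addr_ge0.
  by rewrite powR0 ?gt_eqF// addr_ge0 ?powR_ge0.
have main z : 0 <= z -> z <= a + b -> z / (a + b) * (a + b) `^ s <= z `^ s.
  move=> z0 zab.
  have [->|zn0] := eqVneq z 0; first by rewrite !mul0r powR_ge0.
  have r1 : 0 < z / (a + b) <= 1.
    apply/andP; split; last by rewrite ler_pdivrMr// mul1r.
    by apply: divr_gt0 => //; rewrite lt0r zn0.
  have {2}-> : z = z / (a + b) * (a + b) by rewrite divfK// gt_eqF.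
  rewrite powRM ?(ltW ab0)//; last by case/andP: r1 => /ltW.
  by rewrite ler_wpM2r ?powR_ge0// ger1_powR.
have -> : (a + b) `^ s = a / (a + b) * (a + b) `^ s + b / (a + b) * (a + b) `^ s.
  by rewrite -!mulrDl divff ?mul1r// gt_eqF.
by apply: lerD; apply: main => //; rewrite ?lerDl ?lerDr.
Qed.

(** The convex power p lies above its tangent at [y]. This is Young's inequality for x and y^(p-1)
    with conjugate exponents p and p / (p - 1). *)
Lemma powR_tangent x y p : 0 <= x -> 0 <= y -> 1 < p ->
  y `^ p <= x `^ p + p * y `^ (p - 1) * (y - x).
Proof.
move=> x0 y0 p1.
have p0 : 0 < p by rewrite (lt_trans _ p1).
have p10 : 0 < p - 1 by rewrite subr_gt0.
have := @conjugate_powR R x (y `^ (p - 1)) p (p / (p - 1)) x0 (powR_ge0 _ _) p0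
  (divr_gt0 p0 p10).
rewrite -powRrM (mulrC (p - 1)) divfK ?gt_eqF// => /(_ _) h.
have {}h : x * y `^ (p - 1) <= x `^ p / p + y `^ p / (p / (p - 1)).
  by apply: h; field; rewrite !gt_eqF.
have := ler_wpM2l (ltW p0) h.
rewrite mulrDr [p * (x `^ p / p)]mulrC divfK ?gt_eqF//.
have -> : p * (y `^ p / (p / (p - 1))) = (p - 1) * y `^ p by field; rewrite !gt_eqF.
have := mulr_powRB1 y0 p0.
set u := y `^ (p - 1); set v := y `^ p; set w := x `^ p => e1 e2.
rewrite mulrBr.
have -> : p * u * y = p * v by rewrite -e1; ring.
move: e2; rewrite (mulrC x) mulrA mulrBl mul1r => e2; lra.
Qed.

(** A first-order Taylor expansion whose remainder has order p instead of 2, because the derivative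
    is Hölder of exponent p - 1 <= 1. The positive part keeps the base of the power nonnegative. *)
Lemma powR_add_expansion x z p : 0 <= x -> 1 < p -> p <= 2 ->
  Num.max (x + z) 0 `^ p <= x `^ p + p * x `^ (p - 1) * z + p * `|z| `^ p.
Proof.
move=> x0 p1 p2.
have p0 : 0 < p by rewrite (lt_trans _ p1).
have p10 : 0 < p - 1 by rewrite subr_gt0.
have p11 : p - 1 <= 1 by rewrite lerBlDr.
(* If x + z >= 0, the tangent is taken at x + z, and subadditivity of the power p - 1 moves the
   slope back to x at a cost of at most |z|^(p-1). *)
have [y0|y0] := leP 0 (x + z).
  apply: le_trans (powR_tangent x0 y0 p1) _.
  have -> : x + z - x = z by ring.
  rewrite -[leRHS]addrA lerD2l -!mulrA -mulrDr ler_wpM2l ?(ltW p0)//.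
  rewrite -(mulr_powRB1 (normr_ge0 z) p0).
  have [z0|z0] := leP 0 z.
    rewrite ger0_norm// (mulrC z) -mulrDl ler_wpM2r//.
    exact: powRD_subadd.
  rewrite ltr0_norm//.
  have Nz0 : 0 <= - z by rewrite oppr_ge0 ltW.
  have := powRD_subadd y0 Nz0 p10 p11.
  have -> : x + z + - z = x by ring.
  nra.
rewrite powR0 ?gt_eqF//.
(* Otherwise x < -z, so the negative linear term is dominated by the remainder. *)
have z0 : z < 0 by lra.
rewrite -addrA; apply: addr_ge0; first exact: powR_ge0.
rewrite -mulrA -mulrDr mulr_ge0 ?(ltW p0)//.
rewrite -(mulr_powRB1 (normr_ge0 z) p0) ltr0_norm//.
have : x `^ (p - 1) <= (- z) `^ (p - 1).
  by apply: ge0_ler_powR; rewrite ?nnegrE ?(ltW p10)//; lra.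
nra.
Qed.

End RealPowers.

(** * Growth of normalized sums *)

Section MartingaleGrowth.
Context {d : measure_display} {Omega : measurableType d} {R : realType}.
Variable P : probability Omega R.

Lemma measurable_wrt_mono (F F' : set (set Omega)) d' (T' : measurableType d')
    (f : Omega -> T') :
  sigma_algebra setT F -> sigma_algebra setT F' -> F `<=` F' ->
  measurable_wrt F f -> measurable_wrt F' f.
Proof.
move=> FS FS' FF' mf _ B mB; rewrite setTI measurable_g_measurableTypeE//.
by apply: FF'; exact: measurable_wrt_preimage.
Qed.

Variables (F : nat -> set (set Omega)) (G : nat -> set Omega).
Hypothesis Ffilt : filtration F.
Hypothesis FG : forall n, F n (G n).
Hypothesis Gdec : forall n, G n.+1 `<=` G n.

Let FS n : sigma_algebra setT (F n). Proof. by case: Ffilt. Qed.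
Let FD n : F n `<=` measurable. Proof. by case: Ffilt. Qed.
Let mF n d' (T' : measurableType d') (f : Omega -> T') :
  measurable_wrt (F n) f -> measurable_fun setT f.
Proof. exact: measurable_wrt_sub. Qed.

Lemma measurable_wrt_partial_sum (c : nat -> Omega -> R) n m :
  (forall k, (k < n)%N -> measurable_wrt (F m) (c k)) ->
  measurable_wrt (F m) (fun x => \sum_(k < n) c k x).
Proof.
move=> mc; elim: n mc => [|n IH] mc.
  under eq_fun do rewrite big_ord0.
  exact: measurable_cst.
under eq_fun do rewrite big_ord_recr/=.
apply: measurable_funD; last exact: mc.
by apply: IH => k kn; apply: mc; exact: ltnW.
Qed.

Lemma measurable_wrt_filtration m n d' (T' : measurableType d') (f : Omega -> T') :
  (m <= n)%N -> measurable_wrt (F m) f -> measurable_wrt (F n) f.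
Proof. by move=> mn; apply: measurable_wrt_mono => //; case: Ffilt => _ _; exact. Qed.

(* [X_n / T_n^q + C / (q - 1) * T_n^(1 - q)] is a supermartingale: the increment
   [C c_n / T_(n+1)^q] is paid for by the decrease of [T_n^(1 - q)]. *)
Lemma normalized_growth (X c : nat -> Omega -> R) (q C : R) :
  1 < q -> 0 <= C ->
  (forall n, measurable_wrt (F n) (X n)) -> (forall n x, 0 <= X n x) ->
  (forall x, X 0%N x = 0) ->
  (forall n, measurable_wrt (F n) (c n)) -> (forall n x, 0 <= c n x) ->
  (forall n, cond_le P (F n) (G n) (X n.+1) (fun x => X n x + C * c n x)) ->
  {ae P, forall x, (forall n, G n x) ->
    exists B, forall n, X n x <= B * (1 + \sum_(k < n) c k x) `^ q}.
Proof.
move=> q1 C0 mX X0 X00 mc c0 XX.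
have q10 : 0 < q - 1 by rewrite subr_gt0.
pose K := C / (q - 1).
have K0 : 0 <= K by rewrite divr_ge0// ltW.
pose T n x : R := 1 + \sum_(k < n) c k x.
have T1 n x : 1 <= T n x by rewrite lerDl sumr_ge0.
have T0 n x : 0 < T n x by exact: lt_le_trans (T1 n x).
have TS n x : T n.+1 x = T n x + c n x by rewrite /T big_ord_recr/= addrA.
(* [T] is predictable: [T n.+1] involves only [c 0] to [c n], so it is known at time [n] and may be
   factored out. *)
have mTS n : measurable_wrt (F n) (T n.+1).
  apply: measurable_funD => //; apply: measurable_wrt_partial_sum => k kn.
  exact: measurable_wrt_filtration (mc k).
have mT n : measurable_wrt (F n) (T n).
  case: n => [|n]; last exact: measurable_wrt_filtration (mTS n).
  have -> : T 0%N = cst 1 by apply/funext => x; rewrite /T big_ord0 addr0.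
  exact: measurable_cst.
have TE n x : T n x = 1 + \sum_(k < n) c k x by [].
clearbody T.
have mpow n (f : Omega -> R) (a : R) : measurable_wrt (F n) f ->
    measurable_wrt (F n) (fun x => f x `^ a).
  by move=> mf; exact: (measurableT_comp (measurable_powR a) mf).
pose Psi n x := T n x `^ (- q) * (X n x + K * T n x).
have Psi0 n x : 0 <= Psi n x.
  by rewrite mulr_ge0 ?powR_ge0// addr_ge0// mulr_ge0// ltW.
have mXKT n : measurable_wrt (F n) (fun x => X n x + K * T n x).
  by apply: measurable_funD; [exact: mX|apply: measurable_funM => //; exact: mT].
have mPsi n : measurable_wrt (F n) (Psi n).
  by apply: measurable_funM; [exact: mpow|exact: mXKT].
have PsiS n : cond_le P (F n) (G n) (Psi n.+1) (Psi n).
  have mY : measurable_wrt (F n) (fun x => X n x + C * c n x).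
    by apply: measurable_funD; [exact: mX|apply: measurable_funM => //; exact: mc].
  have Y0 x : 0 <= X n x + C * c n x by rewrite addr_ge0// mulr_ge0.
  have mKT : measurable_wrt (F n) (fun x => K * T n.+1 x).
    by apply: measurable_funM => //; exact: mTS.
  have KT0 x : 0 <= K * T n.+1 x by rewrite mulr_ge0// ltW.
  (* Adding the known term [K * T n.+1] on both sides and multiplying by [T n.+1] to the power -q
     turns the growth hypothesis into a bound on [Psi n.+1]. *)
  have D := cond_leD (@FD n) (mF (mX n.+1)) (X0 n.+1) (mF mY) Y0
    (mF mKT) KT0 (mF mKT) KT0 (XX n) (fun A _ _ => lexx _).
  have M := cond_leM (FS n) (@FD n) (mF (mXKT n.+1))
    (fun x => addr_ge0 (X0 n.+1 x) (KT0 x))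
    (measurable_funD (mF mY) (mF mKT)) (fun x => addr_ge0 (Y0 x) (KT0 x))
    (mpow _ _ (- q) (mTS n)) (fun x => powR_ge0 _ _) D.
  apply: cond_le_trans M _; apply: le_cond_le => //.
  - apply: measurable_funM; first exact: mF (mpow _ _ _ (mTS n)).
    by apply: measurable_funD; [exact: (mF mY)|exact: (mF mKT)].
  - by move=> x; rewrite mulr_ge0 ?powR_ge0// addr_ge0.
  - exact: mF.
  - move=> x; rewrite /Psi /= -addrA !mulrDr; apply: lerD.
      rewrite ler_wpM2r// !powRN lef_pV2 ?posrE ?powR_gt0//.
      apply: ge0_ler_powR; rewrite ?nnegrE ?(ltW (T0 _ _))//.
        by rewrite (le_trans _ (ltW q1)).
      by rewrite TS lerDl.
    have powq t : 0 < t -> t `^ (- q) * t = t `^ (- (q - 1)).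
      move=> t0; rewrite opprB powRB; last by rewrite (gt_eqF t0) implybT.
      by rewrite powRr1 ?ltW// powRN mulrC.
    have := powRN_tangent (T0 n x) (c0 n x) q10.
    rewrite -TS => /(ler_wpM2l K0) h.
    rewrite [X in _ <= X]mulrCA powq//; apply: le_trans h.
    rewrite [X in _ + X <= _]mulrCA powq//.
    have -> : - (q - 1) - 1 = - q by ring.
    rewrite le_eqVlt; apply/orP; left; apply/eqP.
    by rewrite /K; field; rewrite gt_eqF.
have Psifin : (\int[P]_(x in G 0%N) (Psi 0%N x)%:E < +oo)%E.
  rewrite (eq_integral (cst K%:E)); last first.
    move=> x _; congr EFin; rewrite /Psi X00 TE big_ord0 addr0 powR1.
    by rewrite !mul1r mulr1 add0r.
  rewrite integral_cst; last exact: FD.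
  apply: lte_mul_pinfty; rewrite ?lee_fin//.
  by rewrite -ge0_fin_numE// fin_num_measure//; exact: FD (FG 0%N).
apply: filterS (nonneg_supermartingale_bounded Ffilt FG Gdec mPsi Psi0 PsiS Psifin).
move=> x h /h[B PB]; exists B => n; rewrite -TE.
rewrite -ler_pdivrMr ?powR_gt0//; apply: le_trans (PB n).
rewrite /Psi powRN mulrC ler_wpM2l ?invr_ge0 ?powR_ge0// lerDl mulr_ge0//.
exact: ltW.
Qed.

End MartingaleGrowth.

Lemma powR_le1D (R : realType) (t a b : R) : 0 <= t -> 0 <= a -> a <= b ->
  t `^ a <= 1 + t `^ b.
Proof.
move=> t0 a0 ab; have [t1|/ltW t1] := leP t 1.
  apply: (@le_trans _ _ 1); last by rewrite lerDl powR_ge0.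
  have e1 : (1 : R) `^ a = 1 by rewrite powR1.
  by rewrite -[leRHS]e1; apply: ge0_ler_powR; rewrite ?nnegrE.
by apply: (@le_trans _ _ (t `^ b)); [exact: ler_powR|rewrite lerDr].
Qed.

(** * Martingale transforms and weighted squares of the noise *)

Section MartingaleNoise.
Context {d : measure_display} {Omega : measurableType d} {R : realType}.
Variable P : probability Omega R.
Variables (F : nat -> set (set Omega)) (G : nat -> set Omega).
Hypothesis Ffilt : filtration F.
Hypothesis FG : forall n, F n (G n).
Hypothesis Gdec : forall n, G n.+1 `<=` G n.
Variables (eps : nat -> Omega -> R) (gamma kappa : R).
Hypothesis eps_adapted : forall n, measurable_wrt (F n.+1) (eps n).
Hypothesis gamma_gt2 : 2 < gamma.
Hypothesis kappa_ge0 : 0 <= kappa.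
Hypothesis eps_moment : forall n,
  cond_le P (F n) (G n) (fun x => `|eps n x| `^ gamma) (cst kappa).

Let FS n : sigma_algebra setT (F n). Proof. by case: Ffilt. Qed.
Let FD n : F n `<=` measurable. Proof. by case: Ffilt. Qed.
Let mF n d' (T' : measurableType d') (f : Omega -> T') :
  measurable_wrt (F n) f -> measurable_fun setT f.
Proof. exact: measurable_wrt_sub. Qed.
Let meps n : measurable_fun setT (eps n). Proof. exact: mF (@eps_adapted n). Qed.
Let mepsg n : measurable_fun setT (fun x => `|eps n x| `^ gamma).
Proof.
apply: (measurableT_comp (measurable_powR gamma)).
exact: measurableT_comp (@normr_measurable _ _) (meps n).
Qed.

Lemma cond_moment_shift n b : 0 <= b ->
  cond_le P (F n) (G n) (fun x => `|eps n x| `^ gamma + b) (cst (kappa + b)).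
Proof.
move=> b0.
exact: (cond_leD (@FD n) (mepsg n) (fun x => powR_ge0 _ _) (measurable_cst _)
  (fun=> kappa_ge0) (measurable_cst _) (fun=> b0) (measurable_cst _) (fun=> b0)
  (@eps_moment n) (fun A _ _ => lexx _)).
Qed.

Lemma cond_variance n :
  cond_le P (F n) (G n) (fun x => eps n x ^+ 2) (cst (kappa + 1)).
Proof.
apply: (cond_le_trans _ (@cond_moment_shift n 1 ler01)); apply: le_cond_le => //.
- exact: measurable_funX.
- by move=> x; exact: sqr_ge0.
- by apply: measurable_funD.
- move=> x; rewrite -real_normK ?num_real// -powR_mulrn// addrC.
  by apply: powR_le1D => //; exact: ltW.
Qed.

(** The square of the transform grows in conditional mean by at most (kappa + 1) f_n^2, so
    [normalized_growth] applies with q = 3/2. Any q in (1, 2) would make the transform o of its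
    bracket plus a constant, which is what the absorption needs. *)
Lemma martingale_transform_growth (f : nat -> Omega -> R) :
  (forall n, P.-integrable setT (EFin \o eps n)) ->
  (forall n A, F n A -> \int[P]_(x in A) (eps n x)%:E = 0)%E ->
  (forall n, measurable_wrt (F n) (f n)) ->
  {ae P, forall x, (forall n, G n x) -> exists B, forall n,
    (\sum_(k < n) f k x * eps k x) ^+ 2 <=
      B * (1 + \sum_(k < n) f k x ^+ 2) `^ (3 / 2)}.
Proof.
move=> ieps eps0 mf.
pose M n x := \sum_(k < n) f k x * eps k x.
have mM n : measurable_wrt (F n) (M n).
  apply: (measurable_wrt_partial_sum (c := fun k x => f k x * eps k x)) => k kn.
  apply: measurable_funM.
    exact: (measurable_wrt_filtration Ffilt (ltnW kn) (mf k)).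
  exact: (measurable_wrt_filtration Ffilt kn (@eps_adapted k)).
have MS n x : M n.+1 x = M n x + f n x * eps n x by rewrite /M big_ord_recr.
have M0 x : M 0%N x = 0 by rewrite /M big_ord0.
have mM2 n : measurable_wrt (F n) (fun x => M n x ^+ 2).
  by apply: measurable_funX; exact: mM.
have mf2 n : measurable_wrt (F n) (fun x => f n x ^+ 2).
  by apply: measurable_funX; exact: mf.
have me2 n : measurable_fun setT (fun x => eps n x ^+ 2).
  exact: measurable_funX.
apply: (@normalized_growth _ _ _ P F G Ffilt FG Gdec (fun n x => M n x ^+ 2)
  (fun n x => f n x ^+ 2) (3 / 2) (kappa + 1)) => //.
- lra.
- by rewrite addr_ge0.
- by move=> n x; exact: sqr_ge0.
- by move=> x; rewrite M0 expr0n.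
- by move=> n x; exact: sqr_ge0.
move=> n.
pose pos (g : Omega -> R) x := Num.max (g x) 0.
have mpos g : measurable_fun setT g -> measurable_fun setT (pos g).
  by move=> mg; exact: measurable_maxr.
have mposF g : measurable_wrt (F n) g -> measurable_wrt (F n) (pos g).
  by move=> mg; exact: measurable_maxr.
have pos0 g x : 0 <= pos g x by rewrite le_max lexx orbT.
have posB g x : g x = pos g x - pos (\- g) x.
  by rewrite /pos /=; have [|] := leP (g x) 0; have [|] := leP (- g x) 0; lra.
have posD g x : `|g x| = pos g x + pos (\- g) x.
  rewrite /pos /=; have [gx|gx] := leP (g x) 0.
    by rewrite ler0_norm// max_l ?add0r// oppr_ge0.
  by rewrite gtr0_norm// max_r ?addr0// oppr_le0 ltW.
have pos_int A : F n A -> (\int[P]_(x in A) (pos (eps n) x)%:E =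
    \int[P]_(x in A) (pos (\- eps n) x)%:E)%E.
  move=> FA; have mA := FD FA.
  have ineg : P.-integrable A (EFin \o pos (\- eps n)).
    apply: (@le_integrable _ _ _ P A mA _ (EFin \o eps n)).
    - by apply/measurable_EFinP; apply: measurable_funTS; apply: mpos; exact: measurableT_comp.
    - move=> x _ /=; rewrite lee_fin ger0_norm//.
      by rewrite (posD (eps n)) lerDr.
    - by apply: integrableS (ieps n).
  rewrite -[RHS]add0e -(eps0 n A FA) -integralD//; last exact: integrableS (ieps n).
  by apply: eq_integral => x _; rewrite -EFinD [X in (X + _)%:E]posB subrK.
pose al x := 2 * M n x * f n x.
have mal : measurable_wrt (F n) al.
  by apply: measurable_funM; [apply: measurable_funM => //; exact: mM|exact: mf].
have malN : measurable_wrt (F n) (\- al) by exact: measurableT_comp.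
have mepsN : measurable_fun setT (\- eps n) by exact: measurableT_comp.
(* The cross term [al * eps n] has conditional mean zero but may fail to be integrable. It is
   written as [U - V] with [U] and [V] nonnegative; the two parts of [eps n] have equal integrals
   over events of [F n], so [V] dominates [U]. *)
pose U := (pos al \* pos (eps n)) \+ (pos (\- al) \* pos (\- eps n)).
pose V := (pos al \* pos (\- eps n)) \+ (pos (\- al) \* pos (eps n)).
have mprod g h : measurable_fun setT g -> measurable_fun setT h ->
    measurable_fun setT (pos g \* pos h).
  by move=> mg mh; apply: measurable_funM; exact: mpos.
have mUV g h g' h' : measurable_fun setT g -> measurable_fun setT h ->
    measurable_fun setT g' -> measurable_fun setT h' ->
    measurable_fun setT ((pos g \* pos h) \+ (pos g' \* pos h')).
  by move=> *; apply: measurable_funD; exact: mprod.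
have mU : measurable_fun setT U by apply: mUV => //; [exact: (mF mal)|exact: (mF malN)].
have mV : measurable_fun setT V by apply: mUV => //; [exact: (mF mal)|exact: (mF malN)].
have U0 x : 0 <= U x by rewrite addr_ge0// mulr_ge0.
have V0 x : 0 <= V x by rewrite addr_ge0// mulr_ge0.
have UV : cond_le P (F n) (G n) U V.
  apply: cond_leD => //; try solve [exact: (mprod _ _ (mF mal))|exact: (mprod _ _ (mF malN))
    |by move=> x; rewrite mulr_ge0].
  - apply: cond_leM => //; try solve [exact: mpos|exact: mposF].
    by move=> A FA _; rewrite pos_int.
  - apply: cond_leM => //; try solve [exact: mpos|exact: mposF].
    by move=> A FA _; rewrite pos_int.
have mY : measurable_fun setT (fun x => M n x ^+ 2 + f n x ^+ 2 * eps n x ^+ 2).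
  by apply: measurable_funD; [exact: mF|apply: measurable_funM => //; exact: mF].
have step : cond_le P (F n) (G n) (fun x => M n.+1 x ^+ 2)
    (fun x => M n x ^+ 2 + f n x ^+ 2 * eps n x ^+ 2).
  apply: (@cond_le_cancel _ _ _ P (F n) (G n) U V _ _ (fun x => `|al x|)) => //.
  - exact: mF.
  - by move=> x; exact: sqr_ge0.
  - by move=> x; apply: addr_ge0; [exact: sqr_ge0|apply: mulr_ge0; exact: sqr_ge0].
  - exact: measurableT_comp.
  (* Since V <= |al| |eps n|, dividing by 1 + |al| leaves at most |eps n|, which is integrable. *)
  - have /integrableP[_] := ieps n; apply: le_lt_trans; apply: ge0_le_integral => //.
    + by move=> x _; rewrite lee_fin mulr_ge0.
    + apply/measurable_EFinP; apply: measurable_funM => //.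
      have -> : (fun x => (1 + `|al x|)^-1) = fun x => (1 + `|al x|) `^ (-1).
        by apply/funext => x; rewrite powR_inv1.
      apply: (measurableT_comp (measurable_powR (-1))).
      by apply: measurable_funD => //; apply: measurableT_comp => //; exact: (mF mal).
    + by apply: measurableT_comp => //; apply/measurable_EFinP.
    + move=> x _; rewrite lee_fin mulrC ler_pdivrMr ?ltr_pwDl//.
      rewrite /V /= (posD al) (posD (eps n)).
      have := pos0 al x; have := pos0 (\- al) x.
      have := pos0 (eps n) x; have := pos0 (\- eps n) x.
      set a := pos al x; set b := pos (\- al) x.
      set u := pos (eps n) x; set v := pos (\- eps n) x; nra.
  - move=> x; rewrite MS.
    have -> : (M n x + f n x * eps n x) ^+ 2 =
      M n x ^+ 2 + f n x ^+ 2 * eps n x ^+ 2 + al x * eps n x by rewrite /al; ring.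
    rewrite (posB al) (posB (eps n)) /U /V /=; lra.
apply: cond_le_trans step _.
apply: cond_leD => //; try solve [exact: mF|by move=> x; exact: sqr_ge0
  |by move=> x; apply: mulr_ge0; exact: sqr_ge0].
- by apply: measurable_funM => //; exact: mF.
- by apply: measurable_funM => //; exact: mF.
- by move=> x; apply: mulr_ge0; [exact: addr_ge0|exact: sqr_ge0].
have -> : (fun x => (kappa + 1) * f n x ^+ 2) = (fun x => f n x ^+ 2) \* cst (kappa + 1).
  by apply/funext => x; rewrite /= mulrC.
apply: cond_leM => //.
- by move=> x; exact: sqr_ge0.
- by move=> x; rewrite /= addr_ge0.
- by move=> x; exact: sqr_ge0.
- exact: cond_variance.
Qed.


(** With K bounding the conditional variance, the sum of delta (eps^2 - K) has nonpositive drift. As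
    eps^2 is controlled only in order gamma / 2, possibly below 2, the growth of the power p of its
    positive part is followed instead of a square. *)
Lemma weighted_square_growth (delta : nat -> Omega -> R) :
  (forall n, measurable_wrt (F n) (delta n)) ->
  (forall n x, 0 <= delta n x) -> (forall n x, delta n x <= 1) ->
  {ae P, forall x, (forall n, G n x) -> exists B, forall n,
    \sum_(k < n) delta k x * eps k x ^+ 2 <= B * (1 + \sum_(k < n) delta k x)}.
Proof.
move=> mdel del0 del1.
(* [p > 1] is needed to apply [normalized_growth] with q = p, [p <= 2] for the expansion of the
   power, and [2 * p <= gamma] to bound eps^(2p) by the available moment. *)
pose p := Num.min (gamma / 2) 2.
have p1 : 1 < p.
  by rewrite /p lt_min ltr1n andbT ltr_pdivlMr// mul1r.
have p0 : 0 < p by lra.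
have p2 : p <= 2 by rewrite /p ge_min lexx orbT.
have pg : 2 * p <= gamma.
  have : p <= gamma / 2 by rewrite /p ge_min lexx.
  lra.
pose K := kappa + 1.
have K0 : 0 <= K by rewrite addr_ge0.
pose Z n x := \sum_(k < n) delta k x * (eps k x ^+ 2 - K).
have ZS n x : Z n.+1 x = Z n x + delta n x * (eps n x ^+ 2 - K).
  by rewrite /Z big_ord_recr.
have mZ n : measurable_wrt (F n) (Z n).
  apply: (measurable_wrt_partial_sum
    (c := fun k x => delta k x * (eps k x ^+ 2 - K))) => k kn.
  apply: measurable_funM.
    exact: (measurable_wrt_filtration Ffilt (ltnW kn) (mdel k)).
  apply: measurable_funB => //; apply: measurable_funX.
  exact: (measurable_wrt_filtration Ffilt kn (@eps_adapted k)).
pose y n x := Num.max (Z n x) 0.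
have y0 n x : 0 <= y n x by rewrite le_max lexx orbT.
have my n : measurable_wrt (F n) (y n).
  by apply: measurable_maxr => //; exact: mZ.
have mpow n (f : Omega -> R) (a : R) : measurable_wrt (F n) f ->
    measurable_wrt (F n) (fun x => f x `^ a).
  by move=> mf; exact: (measurableT_comp (measurable_powR a) mf).
pose b := 1 + K `^ p.
have b0 : 0 <= b by rewrite addr_ge0 ?powR_ge0.
suff growth : {ae P, forall x, (forall n, G n x) -> exists B, forall n,
    y n x `^ p <= B * (1 + \sum_(k < n) delta k x) `^ p}.
  (* Taking p-th roots makes the positive part of [Z n] at most a multiple of 1 + S, and the
     centring gives back K * S. The absolute value of [B] makes the root monotone whatever the sign
     of [B]. *)
  apply: filterS growth => x h /h[B yB]; exists (`|B| `^ p^-1 + K) => n.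
  set S := \sum_(k < n) delta k x.
  have S0 : 0 <= S by exact: sumr_ge0.
  have {}yB : y n x <= `|B| `^ p^-1 * (1 + S).
    have -> : y n x = (y n x `^ p) `^ p^-1.
      by rewrite -powRrM mulfV ?gt_eqF// powRr1.
    have eS : 1 + S = ((1 + S) `^ p) `^ p^-1.
      by rewrite -powRrM mulfV ?gt_eqF// powRr1// addr_ge0.
    rewrite [X in _ * X]eS.
    rewrite -powRM ?powR_ge0//; apply: ge0_ler_powR.
    - by rewrite invr_ge0 ltW.
    - by rewrite nnegrE powR_ge0.
    - by rewrite nnegrE mulr_ge0 ?powR_ge0.
    - by apply: le_trans (yB n) _; rewrite ler_wpM2r ?powR_ge0// ler_norm.
  have Zy : Z n x <= y n x by rewrite le_max lexx.
  have -> : \sum_(k < n) delta k x * eps k x ^+ 2 = Z n x + K * S.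
    rewrite /Z /S mulr_sumr -big_split/=; apply: eq_bigr => k _; ring.
  rewrite [leRHS]mulrDl; apply: lerD; first exact: le_trans Zy yB.
  by rewrite ler_wpM2l// lerDr.
apply: (@normalized_growth _ _ _ P F G Ffilt FG Gdec (fun n x => y n x `^ p)
  delta p (p * (kappa + b))) => //.
- by apply: mulr_ge0; [exact: ltW|exact: addr_ge0].
- by move=> n; exact: mpow.
- by move=> n x; exact: powR_ge0.
- by move=> x; rewrite /y /Z big_ord0 maxxx powR0// gt_eqF.
move=> n.
(* [h] multiplies eps^2 - K in the linear term of the expansion. Since h eps^2 may not be
   integrable, it is cancelled against h K through [cond_le_cancel]. *)
pose h x := p * y n x `^ (p - 1) * delta n x.
have h0 x : 0 <= h x by rewrite /h !mulr_ge0 ?powR_ge0// ltW.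
have mh : measurable_wrt (F n) h.
  by apply: measurable_funM; [apply: measurable_funM => //; exact: mpow|exact: mdel].
have me2 : measurable_fun setT (fun x => eps n x ^+ 2) by exact: measurable_funX.
have mpd : measurable_wrt (F n) (fun x => p * delta n x).
  by apply: measurable_funM => //; exact: mdel.
have pd0 x : 0 <= p * delta n x by rewrite mulr_ge0// ltW.
have mW : measurable_fun setT (fun x => `|eps n x| `^ gamma + b).
  by apply: measurable_funD.
have W0 x : 0 <= `|eps n x| `^ gamma + b by rewrite addr_ge0 ?powR_ge0.
have mpdW : measurable_fun setT
    (fun x => p * delta n x * (`|eps n x| `^ gamma + b)).
  by apply: measurable_funM => //; exact: (mF mpd).
have yp0 x : 0 <= y n x `^ p by exact: powR_ge0.
have myp m : measurable_fun setT (fun x => y m x `^ p).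
  by apply: (mF (n := m)); exact: mpow.
have step : cond_le P (F n) (G n) (fun x => y n.+1 x `^ p)
    (fun x => y n x `^ p + p * delta n x * (`|eps n x| `^ gamma + b)).
  apply: (@cond_le_cancel _ _ _ P (F n) (G n) (h \* (fun x => eps n x ^+ 2))
    (h \* cst K) _ _ h) => //.
  - by apply: measurable_funM => //; exact: (mF mh).
  - by move=> x; apply: mulr_ge0 => //; exact: sqr_ge0.
  - by apply: measurable_funM => //; exact: (mF mh).
  - by move=> x; exact: mulr_ge0.
  - by move=> x; exact: powR_ge0.
  - exact: measurable_funD.
  - by move=> x; apply: addr_ge0 => //; exact: mulr_ge0.
  - apply: (@le_lt_trans _ _ (\int[P]_x (cst K%:E x))%E).
      apply: ge0_le_integral => //.
      + move=> x _; rewrite lee_fin; apply: mulr_ge0; last exact: mulr_ge0.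
        by rewrite invr_ge0 addr_ge0.
      + apply/measurable_EFinP; apply: measurable_funM.
          have -> : (fun x => (1 + h x)^-1) = fun x => (1 + h x) `^ (-1).
            by apply/funext => x; rewrite powR_inv1// addr_ge0.
          apply: (measurableT_comp (measurable_powR (-1))).
          by apply: measurable_funD => //; exact: (mF mh).
        by apply: measurable_funM => //; exact: (mF mh).
      + move=> x _; rewrite lee_fin /= mulrC ler_pdivrMr ?ltr_pwDl//.
        by rewrite mulrC ler_wpM2l// lerDr.
    rewrite integral_cst//; apply: lte_mul_pinfty; rewrite ?lee_fin//.
    by rewrite -ge0_fin_numE// fin_num_measure.
  - move=> x; set xi := delta n x * (eps n x ^+ 2 - K).
    have yS : y n.+1 x `^ p <= Num.max (y n x + xi) 0 `^ p.
      apply: ge0_ler_powR; rewrite ?nnegrE ?y0 ?(ltW p0)//.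
        by rewrite le_max lexx orbT.
      rewrite {1}/y ZS -/xi ge_max !le_max lexx orbT andbT lerD2r.
      by rewrite /y le_max lexx.
    (* delta^p <= delta because delta lies in [0, 1] and p >= 1, while |eps^2 - K| is at most the
       larger of eps^2 and K; [b] collects the 1 and the K^p. *)
    have xip : `|xi| `^ p <= delta n x * (`|eps n x| `^ gamma + b).
      rewrite normrM (ger0_norm (del0 n x)) powRM//.
      have d1 : delta n x `^ p <= delta n x.
        have [->|dn0] := eqVneq (delta n x) 0; first by rewrite powR0// gt_eqF.
        rewrite -[leRHS]powRr1//; apply: ger_powR (ltW p1).
        by rewrite lt0r dn0 del0 del1.
      apply: ler_pM => //; rewrite ?powR_ge0//.
      have e2 : (eps n x ^+ 2) `^ p <= 1 + `|eps n x| `^ gamma.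
        rewrite -real_normK ?num_real// -powR_mulrn// -powRrM.
        by apply: powR_le1D => //; rewrite mulr_ge0// ltW.
      have e20 := sqr_ge0 (eps n x).
      have [le|/ltW le] := leP (eps n x ^+ 2) K.
        apply: (@le_trans _ _ (K `^ p)).
          apply: ge0_ler_powR; rewrite ?nnegrE ?(ltW p0)//.
          by rewrite ler_norml; apply/andP; split; lra.
        by rewrite /b addrA lerDr addr_ge0 ?powR_ge0.
      apply: (@le_trans _ _ ((eps n x ^+ 2) `^ p)).
        apply: ge0_ler_powR; rewrite ?nnegrE ?(ltW p0)//.
        by rewrite ler_norml; apply/andP; split; lra.
      by apply: le_trans e2 _; rewrite /b addrCA lerD2l lerDl powR_ge0.
    have := le_trans yS (powR_add_expansion xi (y0 n x) p1 p2).
    have := ler_wpM2l (ltW p0) xip.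
    rewrite /h /=; move: (`|xi| `^ p) => w.
    rewrite /xi; set t := y n x `^ (p - 1); set e := eps n x ^+ 2.
    move: t e (delta n x) (y n x `^ p) (y n.+1 x `^ p) (`|eps n x| `^ gamma).
    by move=> *; lra.
  - apply: cond_leM => //.
    + by move=> x; exact: sqr_ge0.
    + exact: cond_variance.
apply: (cond_le_trans step).
have -> : (fun x => y n x `^ p + p * (kappa + b) * delta n x) =
    (fun x => y n x `^ p) \+ ((fun x => p * delta n x) \* cst (kappa + b)).
  by apply/funext => x /=; rewrite mulrAC.
apply: cond_leD => //.
- by move=> x; exact: mulr_ge0.
- by apply: measurable_funM => //; exact: (mF mpd).
- by move=> x; apply: mulr_ge0 => //; exact: addr_ge0.
apply: cond_leM => //.
- by move=> x; exact: addr_ge0.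
- exact: cond_moment_shift.
Qed.

End MartingaleNoise.

(** * Quadratic forms and rank-one updates *)

Section QuadraticForms.
Context {R : realType} {r : nat}.
Implicit Types (A B Q : 'M[R]_r) (x y z : 'cV[R]_r) (a s t : R).

Definition bform A x y : R := (x^T *m A *m y) 0 0.

Lemma bformDl A x y z : bform A (x + y) z = bform A x z + bform A y z.
Proof. by rewrite /bform linearD/= !mulmxDl mxE. Qed.

Lemma bformDr A x y z : bform A x (y + z) = bform A x y + bform A x z.
Proof. by rewrite /bform mulmxDr mxE. Qed.

Lemma bformZl A s x y : bform A (s *: x) y = s * bform A x y.
Proof. by rewrite /bform linearZ/= -!scalemxAl mxE. Qed.

Lemma bformZr A s x y : bform A x (s *: y) = s * bform A x y.
Proof. by rewrite /bform -scalemxAr mxE. Qed.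

Lemma bform_sym A x y : A^T = A -> bform A x y = bform A y x.
Proof.
move=> sA; rewrite /bform -[in LHS](trmxK (x^T *m A *m y)) mxE.
by rewrite !trmx_mul trmxK sA mulmxA.
Qed.

Lemma bform_add A B x y : bform (A + B) x y = bform A x y + bform B x y.
Proof. by rewrite /bform mulmxDr mulmxDl mxE. Qed.

Lemma bform_scalar a x y : bform a%:M x y = a * (x^T *m y) 0 0.
Proof. by rewrite /bform mul_mx_scalar -scalemxAl mxE. Qed.

Lemma bform_outer z x y : bform (z *m z^T) x y = (z^T *m x) 0 0 * (z^T *m y) 0 0.
Proof.
rewrite /bform mulmxA -mulmxA [x^T *m z]mx11_scalar [z^T *m y]mx11_scalar.
rewrite -scalar_mxM !mxE eqxx !mulr1n; congr (_ * _).
by apply: eq_bigr => i _; rewrite !mxE mulrC.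
Qed.

Lemma dotmx_norm2 x : (x^T *m x) 0 0 = norm2 x ^+ 2.
Proof.
rewrite sqr_sqrtr ?sumr_ge0// => [|i _]; last exact: sqr_ge0.
by rewrite mxE; apply: eq_bigr => i _; rewrite mxE expr2.
Qed.

Lemma norm2_ge0 x : 0 <= norm2 x. Proof. exact: sqrtr_ge0. Qed.

Lemma norm2_gt0 x : x != 0 -> 0 < norm2 x.
Proof.
move=> x0; rewrite sqrtr_gt0 lt0r sumr_ge0 ?andbT => [|i _]; last exact: sqr_ge0.
apply: contra x0 => /eqP /psumr_eq0P x0; apply/eqP/matrixP => i j.
by rewrite ord1 mxE; apply/eqP; rewrite -sqrf_eq0 x0// => k _; exact: sqr_ge0.
Qed.

Lemma coord_le_norm2 x i : `|x i 0| <= norm2 x.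
Proof.
rewrite -sqrtr_sqr ler_sqrt; last by apply: sumr_ge0 => k _; exact: sqr_ge0.
by rewrite (bigD1 i)//= lerDl sumr_ge0// => k _; exact: sqr_ge0.
Qed.

Lemma posdefmx_ge0 A x : posdefmx A -> 0 <= bform A x x.
Proof.
move=> [_ Apos]; have [->|x0] := eqVneq x 0; last exact/ltW/Apos.
by rewrite /bform mulmx0 mxE.
Qed.

Lemma posdefmx_unit A : posdefmx A -> A \in unitmx.
Proof.
move=> [sA Apos]; rewrite unitmxE unitfE; apply/det0P => -[v v0 vA0].
have vT0 : v^T != 0 by rewrite trmx_eq0.
by have := Apos _ vT0; rewrite trmxK vA0 mul0mx mxE ltxx.
Qed.

Lemma posdefmx_inv A : posdefmx A -> posdefmx (invmx A).
Proof.
move=> Apos; have uA := posdefmx_unit Apos; case: Apos => sA Apos.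
have sI : (invmx A)^T = invmx A by rewrite trmx_inv sA.
split=> // x x0.
have y0 : invmx A *m x != 0.
  apply: contra x0 => /eqP y0; rewrite -[x](mulKVmx uA) y0 mulmx0//.
have := Apos _ y0; by rewrite trmx_mul sI -!mulmxA mulKVmx// !mulmxA.
Qed.

Lemma posdefmx_rank1 A z : posdefmx A -> posdefmx (A + z *m z^T).
Proof.
move=> [sA Apos]; split=> [|x x0].
  by rewrite linearD/= sA trmx_mul trmxK.
rewrite -/(bform _ x x) bform_add bform_outer -expr2.
by rewrite ltr_wpDr ?sqr_ge0//; exact: Apos.
Qed.

(** Multiplying the left-hand side by Q + z z^T gives the identity, thanks to g + g h = 1. This
    identifies the recursion for P_k with the inverse of the information matrix. *)
Lemma sherman_morrison Q z : Q \in unitmx -> 1 + bform (invmx Q) z z != 0 ->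
  invmx Q - (1 + bform (invmx Q) z z)^-1 *:
     (invmx Q *m z *m z^T *m invmx Q) = invmx (Q + z *m z^T).
Proof.
set h := bform _ _ _; set P := invmx Q; move=> uQ h0.
have zPz : z^T *m P *m z = h%:M by rewrite [LHS]mx11_scalar.
set g := (1 + h)^-1; pose W := P *m z *m z^T.
have e1 : (g *: (W *m P)) *m Q = g *: W by rewrite -scalemxAl mulmxKV.
have e2 : (g *: (W *m P)) *m (z *m z^T) = (g * h) *: W.
  rewrite -scalemxAl -scalerA; congr (g *: _).
  have -> : W *m P *m (z *m z^T) = (P *m z) *m ((z^T *m P *m z) *m z^T).
    by rewrite !mulmxA.
  by rewrite zPz mul_scalar_mx -scalemxAr.
have e3 : P *m (z *m z^T) = W by rewrite mulmxA.
have eW : g *: W + (g * h) *: W = W.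
  by rewrite -scalerDl -{1}[g]mulr1 -mulrDr mulVf// scale1r.
have E : (P - g *: (W *m P)) *m (Q + z *m z^T) = 1%:M.
  rewrite mulmxDr !mulmxBl mulVmx// e1 e2 e3.
  by rewrite -[X in _ + (X - _)]eW addrK subrK.
have [_ uB] := mulmx1_unit E.
by rewrite -[LHS](mulmxK uB) E mul1mx.
Qed.

(** Both sides are the determinant of one bordered matrix, made block triangular by a column
    operation in one case and a row operation in the other. *)
Lemma det_rank1_update Q z : Q \in unitmx ->
  \det (Q + z *m z^T) = \det Q * (1 + bform (invmx Q) z z).
Proof.
move=> uQ.
pose B := block_mx Q (- z) z^T (1%:M : 'M[R]_1).
have E1 : B *m block_mx 1%:M 0 (- z^T) 1%:M = block_mx (Q + z *m z^T) (- z) 0 1%:M.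
  rewrite mulmx_block !mulmx1 !mul1mx !mulmx0 !add0r mulNmx mulmxN opprK.
  by rewrite subrr.
have E2 : block_mx 1%:M 0 (- (z^T *m invmx Q)) 1%:M *m B =
    block_mx Q (- z) 0 (1%:M + z^T *m invmx Q *m z).
  rewrite mulmx_block !mul1mx !mul0mx !addr0 mulNmx mulmxKV// addNr.
  by rewrite mulNmx mulmxN opprK (addrC (z^T *m _ *m z)).
have := congr1 determinant E1; have := congr1 determinant E2.
rewrite !det_mulmx !det_lblock !det_ublock !det1 !mulr1 !mul1r => -> <-.
by rewrite det_mx11 mxE mxE eqxx mulr1n.
Qed.

Lemma rls_energy_step Q (e phi : 'cV[R]_r) (w : R) :
  posdefmx Q ->
  let h := bform (invmx Q) phi phi in
  let u := (phi^T *m e) 0 0 in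
  let e' := e + ((1 + h)^-1 * (w - u)) *: (invmx Q *m phi) in
  bform (Q + phi *m phi^T) e' e' =
    bform Q e e - (1 + h)^-1 * u ^+ 2 + 2 * ((1 + h)^-1 * u * w)
    + (1 - (1 + h)^-1) * w ^+ 2.
Proof.
move=> Qpos h u e'; have uQ := posdefmx_unit Qpos; have [sQ _] := Qpos.
have h0 : 0 <= h by apply: posdefmx_ge0; exact: posdefmx_inv.
set z := invmx Q *m phi.
(* Because Q z = phi, every term of the expansion reduces to h, u and the form at e. *)
have Qz x : bform Q x z = (phi^T *m x) 0 0.
  rewrite /bform /z -mulmxA mulKVmx//.
  by rewrite !mxE; apply: eq_bigr => i _; rewrite !mxE mulrC.
have phiz : (phi^T *m z) 0 0 = h by rewrite /h /bform mulmxA.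
rewrite bform_add bform_outer /e' -/z.
set s := (1 + h)^-1 * (w - u).
have -> : (phi^T *m (e + s *: z)) 0 0 = u + s * h.
  by rewrite mulmxDr -scalemxAr mxE [X in _ + X = _]mxE phiz.
rewrite bformDl !bformDr !bformZl !bformZr (bform_sym z e sQ) !Qz phiz -/u /s.
by field; rewrite gt_eqF// ltr_pwDl.
Qed.

Lemma quadratic_form_ub A : exists2 K, 0 < K & forall x, bform A x x <= K * norm2 x ^+ 2.
Proof.
exists (1 + \sum_i \sum_j `|A i j|).
  by rewrite ltr_pwDl// sumr_ge0// => i _; rewrite sumr_ge0.
move=> x; apply: (@le_trans _ _ ((\sum_i \sum_j `|A i j|) * norm2 x ^+ 2)); last first.
  by rewrite ler_wpM2r ?sqr_ge0// lerDr.
rewrite /bform mxE exchange_big/= mulr_suml; apply: ler_sum => j _.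
rewrite mxE mulr_suml mulr_suml; apply: ler_sum => i _.
rewrite mxE; apply: le_trans (ler_norm _) _.
rewrite !normrM mulrAC mulrC ler_wpM2l// expr2.
by apply: ler_pM => //; exact: coord_le_norm2.
Qed.

(** With K bounding the form of A^-1, nonnegativity is tested at x - K^-1 A^-1 x. The expansion a -
    2 b / K + c / K^2 >= 0, where b = |x|^2 and c <= K b, gives a >= b / K. *)
Lemma psd_unit_coercive A : A^T = A -> A \in unitmx ->
  (forall x, 0 <= bform A x x) ->
  exists2 e, 0 < e & forall x, e * norm2 x ^+ 2 <= bform A x x.
Proof.
move=> sA uA Apsd; have [K K0 KP] := quadratic_form_ub (invmx A).
exists K^-1 => [|x]; first by rewrite invr_gt0.
have := Apsd (x + (- K^-1) *: (invmx A *m x)).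
rewrite bformDl !bformDr !bformZl !bformZr (bform_sym (invmx A *m x) x sA).
have -> : bform A x (invmx A *m x) = norm2 x ^+ 2.
  by rewrite /bform -mulmxA mulKVmx// dotmx_norm2.
have -> : bform A (invmx A *m x) (invmx A *m x) = bform (invmx A) x x.
  by rewrite /bform trmx_mul trmx_inv sA -!mulmxA mulKVmx.
have := KP x; set b := norm2 x ^+ 2; set c := bform _ _ _; set a := bform _ _ _.
move=> cb h.
have : K^-1 * (K^-1 * c) <= K^-1 * b.
  by rewrite ler_wpM2l ?invr_ge0 ?(ltW K0)// ler_pdivrMl.
move: h; rewrite !mulNr !mulrN !opprK; lra.
Qed.

(** The infimum mu of the Rayleigh quotient is an eigenvalue, without any compactness: were Q - mu I
    invertible, [psd_unit_coercive] would raise the lower bound above mu. Every eigenvalue is a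
    Rayleigh quotient, so mu is the least one. *)
Lemma lambda_min_posdef Q : (0 < r)%N -> posdefmx Q ->
  0 < lambda_min Q /\ forall x, lambda_min Q * norm2 x ^+ 2 <= bform Q x x.
Proof.
move=> r0 Qpos; have [sQ Qp] := Qpos.
pose S := [set a | exists2 x : 'cV[R]_r, x != 0 & a = bform Q x x / norm2 x ^+ 2].
have Spos a : S a -> 0 < a.
  by move=> [x x0 ->]; rewrite divr_gt0 ?exprn_gt0 ?norm2_gt0//; exact: Qp.
have Slb : has_lbound S by exists 0 => a /Spos /ltW.
have Sne : S !=set0.
  pose x : 'cV[R]_r := const_mx 1.
  exists (bform Q x x / norm2 x ^+ 2), x => //.
  by apply/eqP => /matrixP/(_ (Ordinal r0) 0)/eqP; rewrite !mxE oner_eq0.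
pose mu := inf S.
have muP x : mu * norm2 x ^+ 2 <= bform Q x x.
  have [->|x0] := eqVneq x 0.
    by rewrite -dotmx_norm2 mulmx0 mxE mulr0; exact: posdefmx_ge0.
  rewrite -ler_pdivlMr ?exprn_gt0 ?norm2_gt0//.
  by apply: ge_inf => //; exists x.
have A_nunit : Q - mu%:M \notin unitmx.
  apply/negP => uA.
  have bA x : bform (Q - mu%:M) x x = bform Q x x - mu * norm2 x ^+ 2.
    by rewrite bform_add -scalemx1 -scaleN1r scalerA scalemx1 bform_scalar dotmx_norm2 mulN1r mulNr.
  have [||e e0 eP] := psd_unit_coercive _ uA.
  - by rewrite linearB/= sQ tr_scalar_mx.
  - by move=> x; rewrite bA subr_ge0.
  suff : mu + e <= mu by rewrite gerDl leNgt e0.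
  apply: lb_le_inf => // a [x x0 ->].
  rewrite ler_pdivlMr ?exprn_gt0 ?norm2_gt0// mulrDl.
  by have := eP x; rewrite bA; lra.
have Emu : eigenvalue Q mu.
  apply/eigenvalueP; move: A_nunit; rewrite unitmxE unitfE negbK => /det0P[v v0 vA].
  exists v => //; apply/eqP; rewrite -subr_eq0 -mul_mx_scalar -mulmxBr vA.
  exact: eqxx.
have Esub a : eigenvalue Q a -> S a.
  move=> /eigenvalueP[v vQ v0]; exists v^T; first by rewrite trmx_eq0.
  rewrite /bform trmxK vQ -scalemxAl mxE -{1}[v in v *m _]trmxK dotmx_norm2.
  by rewrite mulfK// gt_eqF// exprn_gt0// norm2_gt0// trmx_eq0.
have -> : lambda_min Q = mu.
  apply/eqP; rewrite eq_le; apply/andP; split.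
    by apply: ge_inf => //; exists 0 => a /Esub/Spos/ltW.
  apply: lb_le_inf; first by exists mu.
  by move=> a /Esub Sa; exact: ge_inf.
by split => //; exact/Spos/Esub.
Qed.

Lemma det_entries_ub A m : (forall i j, `|A i j| <= m) ->
  `|\det A| <= (factorial r)%:R * m ^+ r.
Proof.
move=> Am; apply: le_trans (ler_norm_sum _ _ _) _.
apply: (@le_trans _ _ (\sum_(s : {perm 'I_r}) m ^+ r)).
  apply: ler_sum => s _; rewrite normrM normrX normrN1 expr1n mul1r normr_prod.
  have -> : m ^+ r = \prod_(i < r) m by rewrite prodr_const card_ord.
  by apply: ler_prod => i _; rewrite normr_ge0 Am.
by rewrite sumr_const card_Sn mulr_natl.
Qed.

End QuadraticForms.

(** * Least squares along one trajectory *)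

Section Trajectory.
Context {R : realType} {r : nat}.
Variables (theta theta0 : 'cV[R]_r) (P0 : 'M[R]_r).
Variables (phi : nat -> 'cV[R]_r) (y w : nat -> R).
Hypothesis P0_posdef : posdefmx P0.
Hypothesis model : forall k, y k.+1 = ((phi k)^T *m theta) 0 0 + w k.+1.

Let P_ := rls_P P0 phi.
Let that := rls_theta theta0 P0 phi y.
Let gain k := rls_gain phi (P_ k) k.

(** This is P_k^-1. The sum stops before k, so [lambda_min_seq P0 phi n] is the smallest eigenvalue
    at index [n.+1]. *)
Definition rls_information k : 'M[R]_r :=
  invmx P0 + \sum_(0 <= j < k) phi j *m (phi j)^T.

Definition rls_residual k : R := ((phi k)^T *m (that k - theta)) 0 0.

Definition rls_energy k : R :=
  bform (rls_information k) (that k - theta) (that k - theta).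

Local Notation Q := rls_information.
Local Notation u := rls_residual.
Local Notation V := rls_energy.

Lemma rls_informationS k : Q k.+1 = Q k + phi k *m (phi k)^T.
Proof. by rewrite /rls_information big_nat_recr//= addrA. Qed.

Lemma rls_information_posdef k : posdefmx (Q k).
Proof.
elim: k => [|k IH]; last by rewrite rls_informationS; exact: posdefmx_rank1.
by rewrite /rls_information big_nil addr0; exact: posdefmx_inv.
Qed.

Let h k := bform (invmx (Q k)) (phi k) (phi k).

Let h_ge0 k : 0 <= h k.
Proof. by apply: posdefmx_ge0; apply: posdefmx_inv; exact: rls_information_posdef. Qed.

Let h1_gt0 k : 0 < 1 + h k. Proof. by rewrite ltr_pwDl. Qed.

Lemma rls_P_invmx k : P_ k = invmx (Q k).
Proof.
elim: k => [|k IH].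
  by rewrite /P_ /rls_information big_nil addr0 invmxK.
rewrite rls_informationS -sherman_morrison; first by rewrite -IH.
  exact: posdefmx_unit (rls_information_posdef k).
by rewrite gt_eqF// h1_gt0.
Qed.

Lemma rls_gainE k : gain k = (1 + h k)^-1.
Proof. by rewrite /gain /rls_gain rls_P_invmx. Qed.

Lemma rls_gain_denom_gt0 k : 0 < 1 + ((phi k)^T *m P_ k *m phi k) 0 0.
Proof. by rewrite rls_P_invmx; exact: h1_gt0. Qed.

Lemma rls_gain_gt0 k : 0 < gain k.
Proof. by rewrite rls_gainE invr_gt0. Qed.

Lemma rls_gain_le1 k : gain k <= 1.
Proof. by rewrite rls_gainE invf_le1// lerDl. Qed.

Lemma rls_energyS k : V k.+1 = V k - gain k * u k ^+ 2 +
  2 * (gain k * u k * w k.+1) + (1 - gain k) * w k.+1 ^+ 2.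
Proof.
rewrite rls_gainE /rls_energy rls_informationS.
have -> : that k.+1 - theta = (that k - theta) +
    ((1 + h k)^-1 * (w k.+1 - u k)) *: (invmx (Q k) *m phi k).
  rewrite /that /= -/(P_ k) -/(gain k) rls_gainE rls_P_invmx addrAC.
  congr (_ + (_ * _) *: _).
  have -> : u k = ((phi k)^T *m that k) 0 0 - ((phi k)^T *m theta) 0 0.
    by rewrite /rls_residual mulmxBr mxE [X in _ + X]mxE.
  by rewrite model /that; ring.
exact: rls_energy_step (rls_information_posdef k).
Qed.

(* The sums start at time 1 because [w_1] need not be centred. *)
Lemma rls_energy_sum n : V n.+1 + \sum_(k < n) gain k.+1 * u k.+1 ^+ 2 =
  V 1%N + 2 * \sum_(k < n) (gain k.+1 * u k.+1) * w k.+2 +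
  \sum_(k < n) (1 - gain k.+1) * w k.+2 ^+ 2.
Proof.
elim: n => [|n IH]; first by rewrite !big_ord0 mulr0 !addr0.
rewrite !big_ord_recr/= rls_energyS.
move: IH; move: (V n.+1) (V 1%N) (\sum_(i < n) _) (\sum_(i < n) _) (\sum_(i < n) _).
move=> *; lra.
Qed.

(** In the energy identity the martingale term is at most a constant plus a sum that the left-hand
    side already contains, since the gain is at most 1. *)
Lemma rls_energy_bound (B1 B2 : R) :
  (forall n, (\sum_(k < n) (gain k.+1 * u k.+1) * w k.+2) ^+ 2 <=
     B1 * (1 + \sum_(k < n) (gain k.+1 * u k.+1) ^+ 2) `^ (3 / 2)) ->
  (forall n, \sum_(k < n) (1 - gain k.+1) * w k.+2 ^+ 2 <=
     B2 * (1 + \sum_(k < n) (1 - gain k.+1))) ->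
  exists2 C, 0 <= C & forall n, V n.+1 <= C * (1 + \sum_(k < n) (1 - gain k.+1)).
Proof.
move=> hB1 hB2; exists (`|V 1%N| + 1 + 16 * B1 ^+ 2 + `|B2|).
  by rewrite !addr_ge0// mulr_ge0// sqr_ge0.
move=> n; have := rls_energy_sum n; have := hB2 n; have := hB1 n.
set m := \sum_(k < n) _ * _; set S2 := \sum_(k < n) _ ^+ 2.
set D := \sum_(k < n) _ * _; set S := \sum_(k < n) (1 - _).
set A := \sum_(k < n) _ * _ => mB DB VE.
have S20 : 0 <= S2 by apply: sumr_ge0 => k _; exact: sqr_ge0.
have S0 : 0 <= S by apply: sumr_ge0 => k _; rewrite subr_ge0 rls_gain_le1.
have S2A : S2 <= A.
  apply: ler_sum => k _; rewrite exprMn ler_wpM2r ?sqr_ge0//.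
  by rewrite expr2 ger_pMr ?rls_gain_gt0 ?rls_gain_le1.
(* With s = sqrt (1 + S2) the hypothesis reads m^2 <= B1 s^3. If s >= 4 B1 this gives m <= s^2 / 2,
   and otherwise m <= 8 B1^2. *)
have m2 : 2 * m <= 1 + S2 + 16 * B1 ^+ 2.
  have T0 : 0 <= 1 + S2 by rewrite addr_ge0.
  pose s := Num.sqrt (1 + S2).
  have s0 : 0 <= s by exact: sqrtr_ge0.
  have sT : s ^+ 2 = 1 + S2 by rewrite sqr_sqrtr.
  have s3 : (1 + S2) `^ (3 / 2) = s ^+ 3.
    by rewrite powRrM powRAC (powR12_sqrt T0) -/s powR_mulrn.
  rewrite s3 in mB; rewrite -sT.
  have [m0|m0] := leP m 0.
    apply: (@le_trans _ _ 0); first by rewrite mulr_ge0_le0.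
    by rewrite addr_ge0 ?sqr_ge0// mulr_ge0// sqr_ge0.
  have [Bs|Bs] := leP (4 * B1) s.
    have : m ^+ 2 <= (s ^+ 2 / 2) ^+ 2.
      apply: le_trans mB _.
      have -> : (s ^+ 2 / 2) ^+ 2 = s / 4 * s ^+ 3 by field.
      by rewrite ler_wpM2r ?exprn_ge0//; lra.
    rewrite ler_pXn2r// ?nnegrE ?(ltW m0) ?divr_ge0 ?sqr_ge0// => mle.
    have := sqr_ge0 B1; lra.
  have B0 : 0 <= B1 by lra.
  have : m ^+ 2 <= (8 * B1 ^+ 2) ^+ 2.
    apply: le_trans mB _.
    have -> : (8 * B1 ^+ 2) ^+ 2 = B1 * (4 * B1) ^+ 3 by ring.
    by rewrite ler_wpM2l// lerXn2r ?nnegrE ?mulr_ge0// ltW.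
  rewrite ler_pXn2r// ?nnegrE ?(ltW m0) ?mulr_ge0 ?sqr_ge0// => mle.
  have := sqr_ge0 s; lra.
have V1 := ler_norm (V 1%N).
have DB' : D <= `|B2| * (1 + S).
  by apply: le_trans DB _; rewrite ler_wpM2r ?addr_ge0// ler_norm.
have X0 : 0 <= (`|V 1%N| + 1 + 16 * B1 ^+ 2) * S.
  by rewrite mulr_ge0// !addr_ge0// mulr_ge0// sqr_ge0.
rewrite mulrDl [X in X + _]mulrDr mulr1; lra.
Qed.

Lemma Rsum_ge1 n : 1 <= Rsum phi n.
Proof. by rewrite lerDl sumr_ge0// => k _; exact: sqr_ge0. Qed.

Lemma Rsum_nondecreasing m n : (m <= n)%N -> Rsum phi m <= Rsum phi n.
Proof.
move=> mn; rewrite /Rsum lerD2l [leRHS](big_cat_nat (n := m.+1))//=.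
by rewrite lerDl sumr_ge0// => k _; exact: sqr_ge0.
Qed.

(** The determinant is multiplied by 1 + h_k at each step and 1 - 1 / (1 + h) <= ln (1 + h), so the
    sum telescopes. *)
Lemma gain_defect_log n :
  \sum_(k < n) (1 - gain k.+1) <= ln `|\det (Q n.+1)| - ln `|\det (Q 1%N)|.
Proof.
elim: n => [|n IH]; first by rewrite big_ord0 subrr.
rewrite big_ord_recr/= [Q n.+2]rls_informationS det_rank1_update; last first.
  exact: posdefmx_unit (rls_information_posdef n.+1).
rewrite -/(h n.+1) normrM (gtr0_norm (h1_gt0 _)) lnM ?posrE ?h1_gt0//; last first.
  rewrite normr_gt0 -unitfE -unitmxE.
  exact: posdefmx_unit (rls_information_posdef n.+1).
suff : 1 - gain n.+1 <= ln (1 + h n.+1) by move: IH; lra.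
rewrite rls_gainE -[X in ln X]invrK lnV ?posrE ?invr_gt0//.
have := expR_ge1Dx (ln (1 + h n.+1)^-1); rewrite lnK ?posrE ?invr_gt0//; lra.
Qed.

(** The entries of the information matrix are at most m R_n, so by the Leibniz formula its
    determinant is at most r! (m R_n)^r. *)
Lemma log_det_information_bound :
  exists C, forall n, ln `|\det (Q n.+1)| <= C + r%:R * ln (Rsum phi n).
Proof.
pose m : R := 1 + \sum_i \sum_j `|invmx P0 i j|.
have m1 : 1 <= m by rewrite lerDl sumr_ge0// => i _; rewrite sumr_ge0.
have m0 : 0 < m by exact: lt_le_trans m1.
exists (ln ((factorial r)%:R * m ^+ r)) => n.
have R1 := Rsum_ge1 n; have R0 : 0 < Rsum phi n by exact: lt_le_trans R1.
have det_gt0 : 0 < `|\det (Q n.+1)|.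
  rewrite normr_gt0 -unitfE -unitmxE.
  exact: posdefmx_unit (rls_information_posdef n.+1).
have fact0 : 0 < (factorial r)%:R :> R by rewrite ltr0n fact_gt0.
rewrite [r%:R * _]mulr_natl -lnXn// -lnM ?posrE ?mulr_gt0 ?exprn_gt0//.
rewrite ler_ln ?posrE ?mulr_gt0 ?exprn_gt0// -mulrA -exprMn.
apply: det_entries_ub => i j; rewrite /rls_information mxE summxE.
apply: le_trans (ler_normD _ _) _.
have e1 : `|invmx P0 i j| <= m - 1.
  rewrite /m addrC addKr (bigD1 i)//= (bigD1 j)//= -addrA lerDl addr_ge0 ?sumr_ge0//.
  by move=> k _; rewrite sumr_ge0.
have e2 : `|\sum_(0 <= k < n.+1) (phi k *m (phi k)^T) i j| <= Rsum phi n - 1.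
  rewrite /Rsum addrC addKr; apply: le_trans (ler_norm_sum _ _ _) _.
  apply: ler_sum => k _; rewrite mxE big_ord1 mxE normrM expr2.
  by apply: ler_pM => //; exact: coord_le_norm2.
(* This product yields (m - 1) + (R_n - 1) <= m R_n. *)
have : 0 <= (m - 1) * (Rsum phi n - 1) by rewrite mulr_ge0 ?subr_ge0.
nra.
Qed.

(** Once a nonzero regressor has appeared, log R_n stays above some l0 > 0, so additive constants
    are absorbed into multiples of log R_n. *)
Lemma rls_rate (B1 B2 : R) : (0 < r)%N -> (exists k, phi k != 0) ->
  (forall n, (\sum_(k < n) (gain k.+1 * u k.+1) * w k.+2) ^+ 2 <=
     B1 * (1 + \sum_(k < n) (gain k.+1 * u k.+1) ^+ 2) `^ (3 / 2)) ->
  (forall n, \sum_(k < n) (1 - gain k.+1) * w k.+2 ^+ 2 <=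
     B2 * (1 + \sum_(k < n) (1 - gain k.+1))) ->
  exists2 C, 0 < C & \forall n \near \oo, norm2 (that n.+1 - theta) <=
    C * Num.sqrt (ln (Rsum phi n) / lambda_min_seq P0 phi n).
Proof.
move=> r0 [k0 phik0] hB1 hB2.
have [C C0 VC] := rls_energy_bound hB1 hB2.
have [C' detC] := log_det_information_bound.
have Rk0 : 1 < Rsum phi k0.
  rewrite /Rsum ltrDl big_nat_recr//=.
  rewrite ltr_wpDl ?exprn_gt0 ?norm2_gt0// sumr_ge0// => k _; exact: sqr_ge0.
pose l0 := ln (Rsum phi k0).
have l00 : 0 < l0 by exact: ln_gt0.
pose c := `|C' - ln `|\det (Q 1%N)| |.
have c0 : 0 <= 1 + c by rewrite addr_ge0 // normr_ge0.
(* From 1 + S <= 1 + c + r L and L >= l0 one gets C (1 + S) <= C ((1 + c) / l0 + r) L; the final 1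
   makes [K] positive. *)
pose K := C * ((1 + c) / l0 + r%:R) + 1.
have K0 : 0 < K.
  apply: ltr_pwDr => //; apply: mulr_ge0 => //; apply: addr_ge0 => //.
  by apply: divr_ge0; [exact: c0|exact: ltW].
exists (Num.sqrt K); first by rewrite sqrtr_gt0.
exists k0 => // n /= k0n.
have Rn : 1 < Rsum phi n by exact: lt_le_trans Rk0 (Rsum_nondecreasing k0n).
have ln0 : l0 <= ln (Rsum phi n).
  by rewrite ler_ln ?posrE ?(lt_trans _ Rk0) ?(lt_trans _ Rn)// Rsum_nondecreasing.
have [lam0 lamP] := lambda_min_posdef r0 (rls_information_posdef n.+1).
have -> : lambda_min_seq P0 phi n = lambda_min (Q n.+1) by [].
rewrite -sqrtrM ?(ltW K0)// -[leLHS](ger0_norm (norm2_ge0 _)) -sqrtr_sqr.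
apply: ler_wsqrtr; rewrite mulrA ler_pdivlMr// mulrC.
apply: le_trans (lamP _) _; rewrite -/(V n.+1).
apply: le_trans (VC n) _.
have := gain_defect_log n; have := detC n.
set S := \sum_(k < n) _; set L := ln (Rsum phi n) => d1 d2.
have SL : S <= c + r%:R * L.
  have := ler_norm (C' - ln `|\det (Q 1%N)|); rewrite -/c; lra.
have cL : 1 + c <= (1 + c) / l0 * L.
  by rewrite mulrAC ler_pdivlMr// ler_wpM2l.
apply: (@le_trans _ _ (C * (((1 + c) / l0 + r%:R) * L))).
  by rewrite ler_wpM2l// mulrDl; lra.
rewrite /K [leRHS]mulrDl mul1r mulrA lerDl; exact: le_trans (ltW l00) ln0.
Qed.

Lemma sparse_estimate_error alpha n : (forall l, theta l 0 != 0 ->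
    alpha n <= `|that n l 0|) ->
  norm2 (sparse_estimate theta0 P0 phi y alpha n - theta) <= norm2 (that n - theta).
Proof.
move=> hal; apply: ler_wsqrtr; apply: ler_sum => l _; rewrite !mxE.
case: ifPn => // lt_al.
have [->|tl0] := eqVneq (theta l 0) 0; first by rewrite subrr expr0n sqr_ge0.
by move: lt_al; rewrite ltNge hal.
Qed.

Lemma sparse_rate alpha (rho : nat -> R) C : 0 < C ->
  rho @ \oo --> (0 : R) -> alpha @ \oo --> (0 : R) ->
  (\forall n \near \oo, norm2 (that n.+1 - theta) <= C * rho n) ->
  \forall n \near \oo,
    norm2 (sparse_estimate theta0 P0 phi y alpha n.+1 - theta) <= C * rho n.
Proof.
move=> C0 rho0 alpha0 hrate.
have alphaS : (fun n => alpha n.+1) @ \oo --> (0 : R) by rewrite cvg_shiftS.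
have hl l : \forall n \near \oo, theta l 0 != 0 ->
    norm2 (that n.+1 - theta) <= C * rho n -> alpha n.+1 <= `|that n.+1 l 0|.
  have [_|tl0] := eqVneq (theta l 0) 0; first by apply: nearW.
  (* Half of |theta(l)| is the margin: eventually the threshold and the estimation error are both
     below it, so the estimate of a nonzero coordinate stays above the threshold. *)
  have e0 : 0 < `|theta l 0| / 2 by rewrite divr_gt0// normr_gt0.
  have ec0 : 0 < `|theta l 0| / 2 / C by rewrite divr_gt0.
  have /cvgrPdist_lt/(_ _ e0) nal := alphaS.
  have /cvgrPdist_lt/(_ _ ec0) nrho := rho0.
  near=> n => _ th_le.
  have al : alpha n.+1 < `|theta l 0| / 2.
    apply: le_lt_trans (ler_norm _) _; rewrite -normrN -sub0r.
    by near: n.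
  have rh : C * rho n < `|theta l 0| / 2.
    rewrite mulrC -ltr_pdivlMr//; apply: le_lt_trans (ler_norm _) _.
    by rewrite -normrN -sub0r; near: n.
  have := coord_le_norm2 (that n.+1 - theta) l.
  rewrite mxE [X in _ + X]mxE distrC => co.
  have := lerB_dist (theta l 0) (that n.+1 l 0); lra.
have hall : \forall n \near \oo, forall l, theta l 0 != 0 ->
    norm2 (that n.+1 - theta) <= C * rho n -> alpha n.+1 <= `|that n.+1 l 0|.
  exact: filter_forall.
near=> n.
have th_le : norm2 (that n.+1 - theta) <= C * rho n by near: n.
apply: (le_trans _ th_le); apply: sparse_estimate_error => l tl0.
by apply: (near hall n).
Unshelve. all: by end_near.
Qed.

End Trajectory.

(** * Measurability and the almost sure bounds *)

Section MatrixMeasurability.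
Context {d : measure_display} {Omega : measurableType d} {R : realType}.
Variable F : set (set Omega).

Definition mx_measurable_wrt m n (A : Omega -> 'M[R]_(m, n)) : Prop :=
  forall i j, measurable_wrt F (fun x => A x i j).

Lemma mx_measurable_cst m n (A : 'M[R]_(m, n)) : mx_measurable_wrt (cst A).
Proof. by move=> i j; exact: measurable_cst. Qed.

Lemma mx_measurableD m n (A B : Omega -> 'M[R]_(m, n)) :
  mx_measurable_wrt A -> mx_measurable_wrt B ->
  mx_measurable_wrt (fun x => A x + B x).
Proof.
move=> mA mB i j; under eq_fun do rewrite mxE.
by apply: measurable_funD; [exact: mA|exact: mB].
Qed.

Lemma mx_measurableB m n (A B : Omega -> 'M[R]_(m, n)) :
  mx_measurable_wrt A -> mx_measurable_wrt B ->
  mx_measurable_wrt (fun x => A x - B x).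
Proof.
move=> mA mB i j; under eq_fun do rewrite !mxE.
by apply: measurable_funB; [exact: mA|exact: mB].
Qed.

Lemma mx_measurableZ m n (a : Omega -> R) (A : Omega -> 'M[R]_(m, n)) :
  measurable_wrt F a -> mx_measurable_wrt A ->
  mx_measurable_wrt (fun x => a x *: A x).
Proof.
move=> ma mA i j; under eq_fun do rewrite mxE.
by apply: measurable_funM; [exact: ma|exact: mA].
Qed.

Lemma mx_measurableM m n p (A : Omega -> 'M[R]_(m, n)) (B : Omega -> 'M[R]_(n, p)) :
  mx_measurable_wrt A -> mx_measurable_wrt B ->
  mx_measurable_wrt (fun x => A x *m B x).
Proof.
move=> mA mB i j; under eq_fun do rewrite mxE.
by apply: measurable_sum => k; apply: measurable_funM; [exact: mA|exact: mB].
Qed.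

Lemma mx_measurable_tr m n (A : Omega -> 'M[R]_(m, n)) :
  mx_measurable_wrt A -> mx_measurable_wrt (fun x => (A x)^T).
Proof. by move=> mA i j; under eq_fun do rewrite mxE; exact: mA. Qed.

End MatrixMeasurability.

(** The bound is a natural number so that the localization runs over a countable family of
    levels. *)
Lemma ereal_sup_lty_bound {R : realType} (Z : nat -> \bar R) :
  (ereal_sup [set Z k | k in [set k | (1 <= k)%N]] < +oo)%E ->
  exists L : nat, forall k, (1 <= k)%N -> (Z k <= L%:R%:E)%E.
Proof.
move=> supZ.
have [L supL] : exists L : nat,
    (ereal_sup [set Z k | k in [set k | (1 <= k)%N]] <= L%:R%:E)%E.
  move: supZ; case: (ereal_sup _) => [s _| //|_]; last by exists 0%N; rewrite leNye.
  exists (Num.Def.truncn s).+1; rewrite lee_fin ltW//.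
  exact: truncnS_gt.
exists L => k k1; apply: le_trans supL; apply: ereal_sup_ubound.
by exists k.
Qed.

Section RecursiveLeastSquares.
Context {d : measure_display} {Omega : measurableType d} {R : realType}.
Variables (P : probability Omega R) (r : nat) (F : nat -> set (set Omega)).
Variables (phi : nat -> Omega -> 'cV[R]_r) (y w : nat -> Omega -> R).
Variables (theta theta0 : 'cV[R]_r) (P0 : 'M[R]_r).
Hypothesis P0_posdef : posdefmx P0.
Hypothesis Ffilt : filtration F.
Hypothesis phi_adapted : forall k i, measurable_wrt (F k) (fun x => phi k x i 0).
Hypothesis model : forall k x, y k.+1 x = ((phi k x)^T *m theta) 0 0 + w k.+1 x.
Hypothesis w_adapted : forall k, (1 <= k)%N -> measurable_wrt (F k) (w k).

Let FS n : sigma_algebra setT (F n). Proof. by case: Ffilt. Qed.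
Let FD n : F n `<=` measurable. Proof. by case: Ffilt. Qed.

Let gain k x := rls_gain (phi^~ x) (rls_P P0 (phi^~ x) k) k.
Let u k x := rls_residual theta theta0 P0 (phi^~ x) (y^~ x) k.

Let mx_measurable_filtration m n p q (A : Omega -> 'M[R]_(p, q)) :
  (m <= n)%N -> mx_measurable_wrt (F m) A -> mx_measurable_wrt (F n) A.
Proof. by move=> mn mA i j; exact: measurable_wrt_filtration (mA i j). Qed.

Let mphi k : mx_measurable_wrt (F k) (phi k).
Proof. by move=> i j; rewrite ord1; exact: phi_adapted. Qed.

(** Measurability of [rls_P] is a hypothesis here because its own induction needs the gain of the
    previous step. *)
Lemma rls_gain_measurable_of k :
  mx_measurable_wrt (F k) (fun x => rls_P P0 (phi^~ x) k) ->
  measurable_wrt (F k) (gain k).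
Proof.
move=> mP.
have -> : gain k = (fun x =>
    (1 + ((phi k x)^T *m rls_P P0 (phi^~ x) k *m phi k x) 0 0) `^ (-1)).
  by apply/funext => x; rewrite powR_inv1// ltW// rls_gain_denom_gt0.
rewrite /measurable_wrt; apply: (measurableT_comp (measurable_powR (-1))).
apply: measurable_funD => //.
apply: (mx_measurableM (A := fun x => (phi k x)^T *m rls_P P0 (phi^~ x) k)) => //.
by apply: mx_measurableM => //; exact: mx_measurable_tr.
Qed.

Lemma rls_P_measurable k :
  mx_measurable_wrt (F k) (fun x => rls_P P0 (phi^~ x) k).
Proof.
elim: k => [|k IH]; first exact: mx_measurable_cst.
apply: (@mx_measurable_filtration k) => //=.
apply: mx_measurableB => //; apply: mx_measurableZ.
  exact: rls_gain_measurable_of.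
apply: mx_measurableM => //; apply: mx_measurableM; last exact: mx_measurable_tr.
exact: mx_measurableM.
Qed.

Lemma rls_gain_measurable k : measurable_wrt (F k) (gain k).
Proof. exact: (rls_gain_measurable_of (@rls_P_measurable k)). Qed.

Lemma rls_theta_measurable k :
  mx_measurable_wrt (F k) (fun x => rls_theta theta0 P0 (phi^~ x) (y^~ x) k).
Proof.
elim: k => [|k IH]; first exact: mx_measurable_cst.
have kk1 := leqnSn k.
have mph := mx_measurable_filtration kk1 (@mphi k).
have mP := mx_measurable_filtration kk1 (@rls_P_measurable k).
have {}IH := mx_measurable_filtration kk1 IH.
have mg := measurable_wrt_filtration Ffilt kk1 (@rls_gain_measurable k).
have my : measurable_wrt (F k.+1) (y k.+1).
  have -> : y k.+1 = fun x => ((phi k x)^T *m theta) 0 0 + w k.+1 x.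
    by apply/funext => x; exact: model.
  apply: measurable_funD; last exact: w_adapted.
  apply: (mx_measurableM (A := fun x => (phi k x)^T)); first exact: mx_measurable_tr.
  exact: mx_measurable_cst.
apply: mx_measurableD => //; apply: mx_measurableZ; last exact: mx_measurableM.
apply: measurable_funM; first exact: mg.
apply: measurable_funB; last first.
  by apply: (mx_measurableM (A := fun x => (phi k x)^T)) => //; exact: mx_measurable_tr.
exact: my.
Qed.

Lemma rls_residual_measurable k : measurable_wrt (F k) (u k).
Proof.
apply: (mx_measurableM (A := fun x => (phi k x)^T)); first exact: mx_measurable_tr.
apply: mx_measurableB; first exact: rls_theta_measurable.
exact: mx_measurable_cst.
Qed.

Lemma noise_sums_bound (gamma : R) (Z : nat -> Omega -> \bar R) : 2 < gamma ->
  (forall k, (1 <= k)%N -> P.-integrable setT (EFin \o w k)) ->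
  (forall k, (1 <= k)%N -> is_cond_expectation P (F k) (EFin \o w k.+1) (cst 0%E)) ->
  (forall k, (1 <= k)%N -> is_cond_expectation P (F k)
     (fun x => (`|w k.+1 x| `^ gamma)%:E) (Z k)) ->
  {ae P, forall x, (ereal_sup [set Z k x | k in [set k | (1 <= k)%N]] < +oo)%E} ->
  {ae P, forall x, exists B1 B2 : R,
    (forall n, (\sum_(k < n) (gain k.+1 x * u k.+1 x) * w k.+2 x) ^+ 2 <=
      B1 * (1 + \sum_(k < n) (gain k.+1 x * u k.+1 x) ^+ 2) `^ (3 / 2)) /\
    (forall n, \sum_(k < n) (1 - gain k.+1 x) * w k.+2 x ^+ 2 <=
      B2 * (1 + \sum_(k < n) (1 - gain k.+1 x)))}.
Proof.
move=> gamma2 w_int w_mds Zw Zsup.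
(* Time is shifted by one because the conditional hypotheses start at index 1: the first centred
   noise is w_2, given [F 1]. *)
pose F' n := F n.+1; pose eps n := w n.+2.
have F'filt : filtration F'.
  case: Ffilt => a b c; split => [k|k|m n mn]; [exact: a|exact: b|exact: c].
(* [G L n] is the event that [Z 1] to [Z n.+1] are at most [L]. It belongs to [F n.+1], and almost
   every point lies in all [G L n] for some [L]. *)
pose G (L : nat) := fix G n := if n is m.+1 then
    G m `&` [set x | (Z n.+1 x <= L%:R%:E)%E] else [set x | (Z 1%N x <= L%:R%:E)%E].
have FZ L n : F' n [set x | (Z n.+1 x <= L%:R%:E)%E].
  have := measurable_wrt_preimage (FS n.+1) (Zw n.+1 isT).1
    (emeasurable_itv `]-oo, L%:R%:E]).
  by congr (F' n _); apply/seteqP; split => x /=; rewrite in_itv.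
have FG L n : F' n (G L n).
  elim: n => [|n IH]; first exact: FZ.
  apply: sigma_algebra_setI; [exact: FS| |exact: FZ].
  by case: Ffilt => _ _ FI; exact: (FI n.+1 n.+2 (leqnSn _)).
have GZ L n x : G L n x -> (Z n.+1 x <= L%:R%:E)%E by case: n => [|n]// [].
have Gdec L n : G L n.+1 `<=` G L n by move=> x [].
have moment (L : nat) n : cond_le P (F' n) (G L n)
    (fun x => `|eps n x| `^ gamma) (cst L%:R).
  move=> A FA AG; have mA := FD FA.
  have [mZ ZE] := Zw n.+1 isT; rewrite -ZE//.
  have mZA : measurable_fun A (Z n.+1).
    by apply: measurable_funTS; exact: measurable_wrt_sub mZ.
  (* A version [Z] is not assumed nonnegative pointwise, so its integral is first bounded by that of
     its positive part, itself at most [L] on [A]. *)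
  rewrite integralE; apply: (@le_trans _ _ (\int[P]_(x in A) (Z n.+1)^\+%E x)%E).
    by rewrite geeDl// oppe_le0 integral_ge0.
  apply: ge0_le_integral => //.
  - exact: measurable_funepos.
  - by apply/measurable_EFinP; exact: measurable_cst.
  - move=> x Ax; rewrite funeposE ge_max; apply/andP; split.
      exact: GZ (AG _ Ax).
    by rewrite lee_fin ler0n.
have eps_int n : P.-integrable setT (EFin \o eps n) by exact: w_int.
have eps0 n A : F' n A -> (\int[P]_(x in A) (eps n x)%:E = 0)%E.
  by move=> FA; have [_ /(_ A FA) <-] := w_mds n.+1 isT; rewrite integral0.
have eps_ad n : measurable_wrt (F' n.+1) (eps n) by exact: w_adapted.
have mf n : measurable_wrt (F' n) (fun x => gain n.+1 x * u n.+1 x).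
  apply: measurable_funM; first exact: (@rls_gain_measurable n.+1).
  exact: (@rls_residual_measurable n.+1).
have mdel n : measurable_wrt (F' n) (fun x => 1 - gain n.+1 x).
  by apply: measurable_funB => //; exact: (@rls_gain_measurable n.+1).
have del0 n x : 0 <= 1 - gain n.+1 x by rewrite subr_ge0 rls_gain_le1.
have del1 n x : 1 - gain n.+1 x <= 1.
  by rewrite gerBl ltW// rls_gain_gt0.
(* Countably many levels leave a single exceptional null set, so [L] may then be chosen depending on
   the point. *)
have A1 := ae_foralln (fun L => martingale_transform_growth F'filt (FG L) (Gdec L)
  eps_ad gamma2 (ler0n _ L) (moment L) eps_int eps0 mf).
have A2 := ae_foralln (fun L => weighted_square_growth F'filt (FG L) (Gdec L)
  eps_ad gamma2 (ler0n _ L) (moment L) mdel del0 del1).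
apply: filterS3 Zsup A1 A2 => x /ereal_sup_lty_bound[L ZL] h1 h2.
have GL n : G L n x.
  by elim: n => [|n IH]; [exact: ZL|split => //; exact: ZL].
by have [B1 ?] := h1 L GL; have [B2 ?] := h2 L GL; exists B1, B2.
Qed.

End RecursiveLeastSquares.

(** * Convergence rate of the sparse estimates *)

Theorem corollary1 (R : realType) (d : measure_display)
  (Omega : measurableType d) (P : probability Omega R)
  (r : nat) (r_gt0 : (0 < r)%N)
  (F : nat -> set (set Omega))
  (phi : nat -> Omega -> 'cV[R]_r) (y w : nat -> Omega -> R)
  (theta theta0 : 'cV[R]_r) (P0 : 'M[R]_r) (alpha : nat -> Omega -> R)
  (P0_posdef : posdefmx P0)
  (F_filtration : filtration F)
  (phi_adapted : forall k i, measurable_wrt (F k) (fun x => phi k x i 0))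
  (model : forall k x, y k.+1 x = ((phi k x)^T *m theta) 0 0 + w k.+1 x)
  (noise_mds : martingale_difference P F w)
  (noise_moment : exists gamma : R, 2 < gamma /\ bounded_cond_moment P F w gamma)
  (excitation : {ae P, forall x,
     (fun n => ln (Rsum (phi^~ x) n) / lambda_min_seq P0 (phi^~ x) n) @ \oo --> (0 : R)})
  (phi_nontrivial : {ae P, forall x, exists k, phi k x != 0})
  (alpha_gt0 : {ae P, forall x, forall n, 0 < alpha n x})
  (alpha_cvg0 : {ae P, forall x, (alpha^~ x) @ \oo --> (0 : R)})
  (alpha_dominates : {ae P, forall x,
     (fun n => Num.sqrt (ln (Rsum (phi^~ x) n) / lambda_min_seq P0 (phi^~ x) n) : R^o)
       =o_\oo (fun n => alpha n x : R^o)}) :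
  {ae P, forall x,
     (fun N => norm2 (sparse_estimate theta0 P0 (phi^~ x) (y^~ x) (alpha^~ x) N.+1
                      - theta) : R^o)
       =O_\oo (fun N => Num.sqrt (ln (Rsum (phi^~ x) N) / lambda_min_seq P0 (phi^~ x) N)
                        : R^o)}.
Proof.
have [w_ad w_int w_mds] := noise_mds.
have [gamma [gamma2 [Z [Zw Zsup]]]] := noise_moment.
have bounds := noise_sums_bound theta0 P0_posdef F_filtration phi_adapted model
  w_ad gamma2 w_int w_mds Zw Zsup.
(* From here the argument is deterministic, along one trajectory outside a null set. *)
apply: filterS3 bounds phi_nontrivial (filterI excitation alpha_cvg0).
move=> x [B1 [B2 [hB1 hB2]]] phi_x [exc alpha_x].
have [C C0 rate] :=
  @rls_rate _ _ _ _ _ _ _ (w^~ x) P0_posdef (model^~ x) _ _ r_gt0 phi_x hB1 hB2.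
apply/eqO_exP; exists C => //.
have rho0 : (fun n => Num.sqrt (ln (Rsum (phi^~ x) n) / lambda_min_seq P0 (phi^~ x) n))
    @ \oo --> (0 : R).
  rewrite -[X in _ --> X]sqrtr0.
  by apply: continuous_cvg exc; exact: sqrt_continuous.
have := sparse_rate C0 rho0 alpha_x rate.
apply: filterS => n; rewrite ger0_norm ?norm2_ge0// ger0_norm//.
Qed.
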